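(* Let $t\ge 1$, and let $F=\bigcup_{i=1}^t C_{2k_i}$ be a (vertex-)disjoint union of even cycles, where $2\le k_1\le k_2\le\cdots\le k_t$ are integers, and let $b=\sum_{i=1}^t k_i$. Let $p>\frac{k_1}{k_1-1}$ be a real number. Then there exists $n_0=n_0(F,p)$ such that the following holds for all $n\ge n_0$. If $G$ is an $F$-free graph on $n$ vertices with $e_p(G)=\mathrm{ex}_p(n,F)$, then \[ G=\begin{cases}L(n,b-1,1), & \text{if } k_i=2 \text{ for all } i;\\ E(n,b-1), & \text{if } k_t\ge 3.\end{cases} \]
   Context: All graphs are finite, simple and undirected; equality of graphs is up to isomorphism. $C_m$ is the cycle on $m$ vertices. A graph is $F$-free if it does not contain $F$ as a (not necessarily induced) subgraph. For real $p>0$, $e_p(G)=\sum_{v\in V(G)}d_G(v)^p$, and $\mathrm{ex}_p(n,F)$ is the maximum of $e_p(G)$ over all $F$-free graphs $G$ on $n$ vertices. The join $G\vee H$ is obtained from vertex-disjoint copies of $G$ and $H$ by adding all edges between them. $L(n,s,1)=K_s\vee L$, where $L$ is the graph on $n-s$ vertices that is a perfect matching if $n-s$ is even, and consists of a matching covering all but one vertex together with one isolated vertex if $n-s$ is odd. $E(n,s)=K_s\vee E^+_{n-s}$, where $E^+_t$ is the graph on $t$ vertices with exactly one edge. *)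

(* Defs.v *)
From HB Require Import structures.
From mathcomp Require Import all_boot all_order all_algebra.
From mathcomp Require Import reals exp.

Set Implicit Arguments.
Unset Strict Implicit.
Unset Printing Implicit Defensive.

Import Order.TTheory GRing.Theory Num.Theory.

Definition simple_adj (V : finType) (e : {ffun V * V -> bool}) : bool :=
  [forall x, ~~ e (x, x)] && [forall x, forall y, e (x, y) == e (y, x)].

(* Adjacency is a finite function, so that the simple graphs on V themselves
   form a finite type over which a maximum can be taken. *)
Record sgraph (V : finType) : Type := SGraph {
  adj_fun : {ffun V * V -> bool};
  adj_funP : simple_adj adj_fun
}.

HB.instance Definition _ (V : finType) := [isSub for @adj_fun V].
HB.instance Definition _ (V : finType) := [Finite of sgraph V by <:].

Definition adj (V : finType) (G : sgraph V) : rel V :=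
  fun x y => adj_fun G (x, y).

Lemma adj_irr (V : finType) (G : sgraph V) : irreflexive (adj G).
Proof. by move=> x; apply: negbTE; case/andP: (adj_funP G) => /forallP/(_ x). Qed.

Lemma adj_sym (V : finType) (G : sgraph V) : symmetric (adj G).
Proof.
by move=> x y; case/andP: (adj_funP G) => _ /forallP/(_ x)/forallP/(_ y)/eqP.
Qed.

(* The simple graph in which distinct x and y are adjacent when r x y or r y x:
   r need be neither symmetric nor irreflexive. *)
Definition adj_of_rel (V : finType) (r : rel V) : {ffun V * V -> bool} :=
  [ffun u => (u.1 != u.2) && (r u.1 u.2 || r u.2 u.1)].

Lemma adj_of_relP (V : finType) (r : rel V) : simple_adj (adj_of_rel r).
Proof.
apply/andP; split; first by apply/forallP => x; rewrite ffunE eqxx.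
by apply/forallP => x; apply/forallP => y; rewrite !ffunE /= [y == x]eq_sym orbC.
Qed.

Definition graph_of_rel (V : finType) (r : rel V) : sgraph V :=
  SGraph (adj_of_relP r).

Lemma adj_graph_of_rel (V : finType) (r : rel V) (x y : V) :
  adj (graph_of_rel r) x y = (x != y) && (r x y || r y x).
Proof. by rewrite /adj ffunE. Qed.

Definition isomorphic (V W : finType) (G : sgraph V) (H : sgraph W) : Prop :=
  exists2 f : V -> W, bijective f & forall x y, adj H (f x) (f y) = adj G x y.

(* H contains F as a not necessarily induced subgraph. *)
Definition contains (U V : finType) (F : sgraph U) (H : sgraph V) : bool :=
  [exists f : {ffun U -> V},
     injectiveb f && [forall x, forall y, adj F x y ==> adj H (f x) (f y)]].

Definition graph_free (U V : finType) (F : sgraph U) (H : sgraph V) : bool :=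
  ~~ contains F H.

Definition degree (V : finType) (G : sgraph V) (x : V) : nat :=
  #|[set y | adj G x y]|.

Definition degree_power (R : realType) (p : R) (V : finType) (G : sgraph V) : R :=
  (\sum_(x : V) ((degree G x)%:R `^ p))%R.

(* The default value 0 of the maximum is harmless: degree powers are
   nonnegative. *)
Definition ex_degree_power (R : realType) (p : R) (n : nat)
    (U : finType) (F : sgraph U) : R :=
  (\big[Num.max/0]_(G : sgraph 'I_n | graph_free F G) degree_power p G)%R.

Definition complete_graph (m : nat) : sgraph 'I_m := graph_of_rel (fun _ _ => true).

(* Meant for m >= 3. *)
Definition cycle_graph (m : nat) : sgraph 'I_m :=
  graph_of_rel (fun i j : 'I_m => j == i.+1 %% m :> nat).

(* The edges are {0, 1}, {2, 3}, ...; the last vertex is isolated if m is odd. *)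
Definition matching_graph (m : nat) : sgraph 'I_m :=
  graph_of_rel (fun i j : 'I_m => i./2 == j./2).

(* The only edge is {0, 1}; meant for m >= 2. *)
Definition one_edge_graph (m : nat) : sgraph 'I_m :=
  graph_of_rel (fun i j : 'I_m => (i == 0 :> nat) && (j == 1 :> nat)).

Definition graph_join (V W : finType) (G : sgraph V) (H : sgraph W) :
    sgraph (V + W)%type :=
  graph_of_rel (fun u v : (V + W)%type =>
    match u, v with
    | inl x, inl y => adj G x y
    | inr x, inr y => adj H x y
    | _, _ => true
    end).

Definition disjoint_union (I : finType) (T : I -> finType)
    (G : forall i, sgraph (T i)) : sgraph {i : I & T i} :=
  graph_of_rel (fun u v : {i : I & T i} =>
    (tag u == tag v) && adj (G (tag u)) (tagged u) (tagged_as u v)).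

(* The disjoint union of C_(2 k 1), ..., C_(2 k t); the sequence k is indexed
   from 1 and its values outside 1, ..., t are not used. *)
Definition even_cycles (t : nat) (k : nat -> nat) :=
  disjoint_union (fun i : 'I_t => cycle_graph (2 * k i.+1)).

Definition graph_L1 (n s : nat) :=
  graph_join (complete_graph s) (matching_graph (n - s)).

Definition graph_E (n s : nat) :=
  graph_join (complete_graph s) (one_edge_graph (n - s)).

(* Main.v *)
(* Bondy-Simonovits: in a bipartite graph of large minimum degree, breadth-first
   layers grow by a factor q unless some two consecutive layers span a dense
   graph, and a dense graph between layers yields a C_2k (see level_cycle).
   Hence an F-free graph on fewer than q^(k_1) vertices has O(q n) edges;
   cutting the larger side into blocks of size m, a set of m vertices of an
   F-free graph has degree sum O(n m^(1/k_1)). So the m-th largest degree is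
   O(n m^(1/k_1 - 1)), and as p (1 - 1/k_1) > 1 all but boundedly many vertices
   contribute at most eps n^p to e_p.  Among the remaining ones, having no K_(b,b)
   bounds the degree sum by about (b - 1) n, so if e_p is extremal then exactly
   b - 1 hubs have almost full degree.  Let X be the common neighbourhood of
   the hubs, and y the number of vertices that are neither hubs nor in X.
   A path on 3 vertices with both ends in X (or, if k_t >= 3, two disjoint
   edges in X) completes to a copy of F, so outside the hubs every vertex has at most one
   neighbour in X.  The y exceptional vertices then gain only O(y^p), which is
   less than the y (n - 1)^(p - 1) lost at the hubs: thus y = 0, and equality
   with the target graph determines G. *)
Require Import Defs.
From mathcomp Require Import all_boot all_order all_algebra.
From mathcomp Require Import reals sequences exp.
From mathcomp Require Import zify ring lra.

Set Implicit Arguments.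
Unset Strict Implicit.
Unset Printing Implicit Defensive.

Import Order.TTheory GRing.Theory Num.Theory.

(** * Degrees into a set *)

Section Degrees.
Variables (V : finType) (e : rel V).
Implicit Types (S U : {set V}).

Definition deg S x := #|[set y in S | e x y]|.

Lemma degE S x : deg S x = \sum_(y in S) e x y.
Proof.
by rewrite /deg -sum1_card big_mkcond [RHS]big_mkcond; apply: eq_bigr => y _; rewrite inE;
  case: (y \in S); case: (e x y).
Qed.

Lemma deg_subset S U x : S \subset U -> deg S x <= deg U x.
Proof.
move=> /subsetP SU; apply/subset_leq_card/subsetP => y; rewrite !inE.
by case/andP => /SU -> ->.
Qed.

Lemma deg_le_card S x : deg S x <= #|S|.
Proof. by apply/subset_leq_card/subsetP => y; rewrite inE => /andP[]. Qed.

Lemma degD1 S x y : x \in S -> deg S y = deg (S :\ x) y + e y x.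
Proof. by move=> xS; rewrite !degE (big_setD1 x xS) /= addnC. Qed.

Lemma degU S U x : [disjoint S & U] -> deg (S :|: U) x = deg S x + deg U x.
Proof. by move=> dSU; rewrite !degE -bigU //; apply: eq_bigl => y; rewrite !inE. Qed.

Lemma sum_degC S U : symmetric e ->
  \sum_(x in S) deg U x = \sum_(x in U) deg S x.
Proof.
move=> e_sym; under eq_bigr do rewrite degE.
rewrite exchange_big; apply: eq_bigr => y _; rewrite degE.
by apply: eq_bigr => x _; rewrite e_sym.
Qed.

Lemma sum_deg_setD1 S x : symmetric e -> x \in S ->
  \sum_(y in S) deg S y <= \sum_(y in S :\ x) deg (S :\ x) y + (deg S x).*2.
Proof.
move=> e_sym xS; rewrite (big_setD1 x xS) /= -addnn addnCA leq_add2l.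
under eq_bigr => y _ do rewrite (degD1 y xS).
rewrite big_split leq_add2l /= [leqRHS]degE (big_setD1 x xS) /=.
by under eq_bigr => y _ do rewrite e_sym; rewrite leq_addl.
Qed.

(** Deleting a vertex of degree at most [d] lowers the degree sum by at most [2 d], so such
    deletions cannot exhaust [S]. *)
Lemma min_degree_subset S d : symmetric e ->
  (d * #|S|).*2 < \sum_(x in S) deg S x ->
  exists U, [/\ U \subset S, U != set0 & forall x, x \in U -> d < deg U x].
Proof.
move=> e_sym; have [n] := ubnP #|S|; elim: n S => // n IH S leSn hS.
have [/forall_inP all_big|] := boolP [forall x in S, d < deg S x].
  exists S; split=> //; apply: contraTneq hS => ->; by rewrite big_set0.
rewrite negb_forall_in => /exists_inP[x xS]; rewrite -leqNgt => dx.
have [||U [US Un Udeg]] := IH (S :\ x).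
- by move: leSn; rewrite (cardsD1 x) xS.
- have := sum_deg_setD1 e_sym xS; move: hS; rewrite (cardsD1 x S) xS; nia.
by exists U; split=> //; apply: subset_trans US (subD1set _ _).
Qed.

End Degrees.

(* The vertices are coloured one by one, each opposite to the majority of its
   coloured neighbours. *)
Lemma max_cut (V : finType) (e : rel V) (S : {set V}) :
  symmetric e -> irreflexive e ->
  exists c : V -> bool, \sum_(x in S) deg e S x <=
    (\sum_(x in S) deg (fun x y => e x y && (c x != c y)) S x).*2.
Proof.
move=> e_sym e_irr; have [n] := ubnP #|S|; elim: n S => // n IH S leSn.
have [->|[x xS]] := set_0Vmem S; first by exists xpredT; rewrite big_set0.
have [|c hc] := IH (S :\ x); first by move: leSn; rewrite (cardsD1 x) xS.
pose N b := \sum_(y in S :\ x) (e x y && (c y == b)).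
pose b := N true <= N false.
have NN : N true + N false = deg e (S :\ x) x.
  rewrite degE -big_split; apply: eq_bigr => y _ /=.
  by case: (e x y) (c y) => [] [].
exists (fun y => if y == x then b else c y).
have sumS (f : rel V) : symmetric f -> irreflexive f ->
    \sum_(y in S) deg f S y = \sum_(y in S :\ x) deg f (S :\ x) y + (deg f (S :\ x) x).*2.
  move=> f_sym f_irr; rewrite (big_setD1 x xS) /= (degD1 _ _ xS) f_irr addn0.
  rewrite -addnn addnCA; congr (_ + _).
  under eq_bigr => y _ do rewrite (degD1 f y xS).
  rewrite big_split /=; congr (_ + _); rewrite degE; apply: eq_bigr => y _.
  by rewrite f_sym.
rewrite sumS // sumS; last first.
- by move=> y; rewrite e_irr.
- by move=> y z; rewrite e_sym eq_sym.
rewrite doubleD leq_add //.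
  apply: leq_trans hc _; rewrite leq_double; apply: leq_sum => y; rewrite !inE => /andP[yx yS].
  apply/subset_leq_card/subsetP => z; rewrite !inE => /andP[/andP[zx zS] eyz].
  by rewrite zx zS /= (negbTE yx) (negbTE zx).
rewrite leq_double;
  suff -> : deg (fun y z => e y z && ((if y == x then b else c y) != (if z == x then b else c z))) (S :\ x) x = N (~~ b).
  by rewrite -NN /b -addnn; case h: (N true <= N false) => /=;
    rewrite ?leq_add2r ?leq_add2l // leqNgt -ltnNge in h *; lia.
rewrite degE; apply: eq_bigr => y; rewrite !inE => /andP[yx yS].
by rewrite eqxx (negbTE yx) eq_sym; case: b (c y) => [] [].
Qed.

(** * Even cycles between two levels of a tree *)

(** Greedy choice: each vertex used joins the forbidden set [Z] while [l] drops by one, so the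
    degree hypothesis persists. The start [x] itself may lie in [Z]. *)
Lemma path_extend (V : finType) (f : rel V) (U Z : {set V}) (x : V) (l : nat) :
  x \in U -> (forall v, v \in U -> #|Z| + l < deg f U v) ->
  exists p, [/\ path f x p, size p = l, uniq (x :: p), {subset p <= U}
    & forall v, v \in p -> v \notin Z].
Proof.
elim: l Z x => [|l IH] Z x xU hdeg; first by exists [::].
have [y] : exists y, y \in [set y in U | f x y] :\: (x |: Z).
  apply/set0Pn; rewrite -card_gt0 cardsD subn_gt0.
  apply: leq_ltn_trans (hdeg x xU); apply: leq_trans (subset_leq_card (subsetIr _ _)) _.
  by rewrite cardsU1; case: (x \in Z) => /=; lia.
rewrite !inE negb_or => /and3P[/andP[yx yZ] yU fxy].
have [|p [pth szp unp pU pZ]] := IH (x |: Z) y yU.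
  move=> v /hdeg; apply: leq_trans; rewrite cardsU1; case: (x \in Z) => /=; lia.
exists (y :: p); split => //=.
- by rewrite fxy.
- by rewrite szp.
- move: unp => /= ->; rewrite inE negb_or eq_sym yx andbT.
  by apply/negP => /pZ; rewrite !inE eqxx.
- by move=> z; rewrite inE => /predU1P[->|/pU].
- move=> z; rewrite inE => /predU1P[->//|/pZ]; rewrite !inE negb_or; by case/andP.
Qed.

Lemma level_cases i m : i <= m <= i.+1 -> m = i \/ m = i.+1.
Proof. lia. Qed.

Section Levels.
Variables (V : finType) (e : rel V) (lev : V -> nat) (par : V -> V) (i : nat).
Hypothesis e_sym : symmetric e.
Hypothesis par_edge : forall v, 0 < lev v <= i ->
  e v (par v) /\ (lev (par v)).+1 = lev v.

Lemma lev_iter_par v m : lev v <= i -> m <= lev v -> lev (iter m par v) = lev v - m.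
Proof.
move=> vi; elim: m => [|m IH] mv /=; first by rewrite subn0.
have [|_] := @par_edge (iter m par v); first by rewrite IH; lia.
rewrite IH; lia.
Qed.

Lemma path_par v m : lev v <= i -> m <= lev v ->
  path (fun x y => e x y && (lev y < lev x)) v (traject par (par v) m).
Proof.
elim: m v => // m IH v vi mv; have [|evp lp] := @par_edge v; first by lia.
by rewrite trajectS /= evp IH //=; lia.
Qed.

(** The tree paths from both ends of [p] first meet at height [j + 1]: an earlier meeting would
    identify the ancestors at height [j]. They run on levels less than [i], hence avoid [p]. *)
Lemma tree_cycle a p j : lev a = i -> lev (last a p) = i -> j < i ->
  path e a p -> uniq (a :: p) -> (forall v, v \in p -> i <= lev v) ->
  iter j par a != iter j par (last a p) ->
  iter j.+1 par a = iter j.+1 par (last a p) ->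
  exists c, [/\ cycle e c, uniq c & size c = size p + j.+1.*2].
Proof.
move=> la lb ji pth unp plev; set b := last a p => njab jab.
have trP x v m : lev x = i -> m <= i -> v \in traject par (par x) m ->
    exists2 m', m' < m & v = iter m'.+1 par x /\ lev v = i - m'.+1.
  move=> lx mi /trajectP[m' m'm ->]; exists m' => //; rewrite -iterSr; split=> //.
  by rewrite lev_iter_par; lia.
(* Along [p] to [b], up to the common ancestor, and back down to [a]; the second tree path has only
   [j] vertices, as the ancestor is already listed. *)
exists (a :: p ++ traject par (par b) j.+1 ++ rev (traject par (par a) j)).
split; last by rewrite -cat_cons !size_cat size_rev !size_traject /=; lia.
- have sub : subrel (fun x y => e x y && (lev y < lev x)) e by move=> x y /andP[].
  have pb : path e b (traject par (par b) j.+1).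
    by apply: (sub_path sub); apply: path_par; rewrite ?la ?lb.
  have pa : path e a (traject par (par a) j.+1).
    by apply: (sub_path sub); apply: path_par; rewrite ?la ?lb.
  move: pb pa; have := last_traject par b j.+1; have := last_traject par a j.+1.
  rewrite -jab (trajectSr _ (par a)); set T := traject _ _ j.+1 => lT lT' pb.
  rewrite -rev_path belast_rcons lT (eq_path (e' := e)) => [pa|x y]; last exact: e_sym.
  by rewrite /cycle rcons_cat cat_path pth rcons_cat cat_path pb lT' -rev_cons.
- have uniqtr x m : lev x = i -> m <= i -> uniq (traject par (par x) m).
    move=> lx mi; have := path_par (v := x) (m := m) ltac:(lia) ltac:(lia).
    have sub : subrel (fun x y => e x y && (lev y < lev x)) (fun x y => lev y < lev x) by move=> ? ? /andP[].
    move=> /(sub_path sub)/path_sorted; apply: sorted_uniq; first by move=> ? ? ? /[swap];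
      apply: ltn_trans.
    by move=> ?; rewrite ltnn.
  rewrite -cat_cons cat_uniq unp cat_uniq rev_uniq !uniqtr ?(ltnW ji) ?lb //.
  rewrite andTb andbT; apply/andP; split; apply/hasPn => v.
    rewrite mem_cat mem_rev => vT; have lv : lev v < i.
      by case/orP: vT => /trP[] //; lia.
    rewrite inE negb_or; apply/andP; split.
      by apply: contraTneq lv => ->; rewrite la ltnn.
    by apply: contraTN lv => /plev; rewrite leqNgt.
  rewrite mem_rev => /(trP _ _ _ la (ltnW ji))[m mj [vm lv]].
  apply/negP => /(trP _ _ _ lb ji)[m' m'j [vm' lv']].
  have mm : m' = m by lia.
  rewrite mm in vm'; case/eqP: njab.
  have -> : j = (j - m.+1) + m.+1 by lia.
  by rewrite !iterD -vm -vm'.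
Qed.

(* Induction on the height j + 1 of a common ancestor of the vertices of U on
   level i. If every vertex of U on level i + 1 has all its neighbours in U below
   one child of that ancestor, restrict U to such a child. Otherwise a path of
   length 2 (k - j - 1) joins vertices below distinct children, and the tree
   paths to the ancestor close it into a 2k-cycle. *)
Lemma level_cycle k U : (forall u v, lev u = 0 -> lev v = 0 -> u = v) ->
  0 < i < k -> U != set0 -> (forall v, v \in U -> i <= lev v <= i.+1) ->
  (forall v, v \in U -> k.*2.+2 < deg (fun x y => e x y && (lev x != lev y)) U v) ->
  exists c, [/\ cycle e c, uniq c & size c = k.*2].
Proof.
move=> root /andP[i0 ik]; set h := fun x y => _.
have h_sym : symmetric h by move=> x y; rewrite /h e_sym eq_sym.
suff gen j U' : j <= i -> U' != set0 -> (forall v, v \in U' -> i <= lev v <= i.+1) ->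
  (forall v, v \in U' -> k.*2.+2 < deg h U' v) ->
  (forall u v, u \in U' -> v \in U' -> lev u = i -> lev v = i -> iter j par u = iter j par v) ->
  exists c, [/\ cycle e c, uniq c & size c = k.*2].
  move=> U0 Ulev Udeg; apply: (gen i U) => // u v _ _ lu lv; apply: root;
    rewrite lev_iter_par ?lu ?lv; lia.
elim: j U' => {U} [|j IH] U ji U0 Ulev Udeg Ucls.
  (* For [j = 0], [U] has at most one vertex on level [i], so a vertex on level [i + 1] would have
     degree at most 1. Then no edge of [h] remains in [U]. *)
  have nbr v : v \in U -> lev v <> i.+1.
    move=> vU lv; have [/Udeg] := (vU, I).
    rewrite ltnNge => /negP[]; apply: (@leq_trans 1); last by [].
    apply/card_le1_eqP => x y; rewrite !inE => /andP[xU /andP[_ lx]] /andP[yU /andP[_ ly]].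
    have := Ulev x xU; have := Ulev y yU => ? ?; apply: Ucls => //; lia.
  have /set0Pn[v vU] := U0.
  have : 0 < deg h U v by apply: leq_trans (Udeg v vU).
  rewrite card_gt0 => /set0Pn[x]; rewrite !inE => /andP[xU /andP[_ lx]].
  have := Ulev x xU; have := Ulev v vU; have := nbr x xU; have := nbr v vU; lia.
pose cls := iter j par.
(* Edges of [h] alternate between levels [i] and [i + 1], so an even path from level [i] ends on
   level [i]. *)
have pathlev x p : x \in U -> path h x p -> {subset p <= U} -> odd (lev (last x p)) = odd (lev x) (+) odd (size p).
  elim: p x => [|y p IHp] x xU /=; first by rewrite addbF.
  case/andP => /andP[_ lxy] pth sub; have yU : y \in U by apply: sub; rewrite mem_head.
  rewrite IHp //; last by move=> z zp; apply: sub; rewrite inE zp orbT.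
  have := Ulev x xU; have := Ulev y yU; case: (odd (size p)) => /=; lia.
have samecls p a : a \in U -> lev a = i -> path h a p -> uniq (a :: p) -> {subset p <= U} ->
    size p = (k - j.+1).*2 -> cls a != cls (last a p) -> exists c, [/\ cycle e c, uniq c & size c = k.*2].
  move=> aU la pth unp sub szp ncls.
  have laU : last a p \in U.
    by have := mem_last a p; rewrite inE => /predU1P[->//|/sub].
  have lb : lev (last a p) = i.
    have := pathlev a p aU pth sub; rewrite szp odd_double addbF la.
    have := Ulev _ laU; lia.
  have [|||||c [cc uc sc]] := @tree_cycle a p j la lb ji.
  - by apply: sub_path pth => x y /andP[].
  - by [].
  - by move=> v /sub /Ulev /andP[].
  - by [].
  - exact: Ucls.
  - by exists c; split => //; rewrite sc szp; lia.
have [/forall_inP same|] := boolP [forall t in U, [forall u in U, forall v in U,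
    h t u ==> h t v ==> (lev t == i.+1) ==> (cls u == cls v)]].
  have same' t u v : t \in U -> u \in U -> v \in U -> h t u -> h t v -> lev t = i.+1 -> cls u = cls v.
    move=> tU uU vU htu htv lt; have /forall_inP/(_ u uU)/forall_inP/(_ v vU) := same t tU.
    by rewrite htu htv lt eqxx => /eqP.
  have [x0 x0U lx0] : exists2 x, x \in U & lev x = i.
    have /set0Pn[v vU] := U0; have := Ulev v vU.
    have [lv _|lv lv2] := eqVneq (lev v) i; first by exists v.
    have : 0 < deg h U v by apply: leq_trans (Udeg v vU).
    rewrite card_gt0 => /set0Pn[x]; rewrite !inE => /andP[xU /andP[_ lx]].
    exists x => //; have := Ulev x xU; lia.
  (* No degree is lost: by [same'], a vertex on level [i + 1] with one neighbour in the class of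
     [x0] has all its neighbours there. *)
  pose U1 := [set v in U | (lev v == i) && (cls v == cls x0)
     || (lev v == i.+1) && [exists u in U, h v u && (cls u == cls x0)]].
  apply: (IH U1) => //.
  - by apply: ltnW.
  - by apply/set0Pn; exists x0; rewrite !inE x0U lx0 !eqxx.
  - by move=> v; rewrite inE => /andP[/Ulev].
  - move=> v; rewrite inE => /andP[vU hv]; apply: leq_trans (Udeg v vU) _.
    apply/subset_leq_card/subsetP => y; rewrite !inE => /andP[yU hvy].
    rewrite yU hvy /= andbT; case/orP: hv => /andP[/eqP lv].
      move=> cv; apply/orP; right; apply/andP; split.
        by move: hvy => /andP[_]; have := Ulev y yU; rewrite lv; lia.
      by apply/exists_inP; exists v => //; rewrite h_sym hvy.
    move=> /exists_inP[u uU /andP[hvu /eqP cu]]; apply/orP; left; apply/andP; split.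
      by move: hvy => /andP[_]; have := Ulev y yU; rewrite lv; lia.
    by rewrite -cu (same' v y u).
  - move=> u v; rewrite !inE => /andP[uU hu] /andP[vU hv] lu lv.
    by move: hu hv; rewrite lu lv !eqxx /= !(ltn_eqF (ltnSn i)) !orbF => /eqP + /eqP;
      rewrite /cls => -> ->.
rewrite negb_forall => /existsP[t]; rewrite negb_imply => /andP[tU].
rewrite negb_forall => /existsP[u]; rewrite negb_imply => /andP[uU].
rewrite negb_forall => /existsP[v]; rewrite !negb_imply => /and5P[vU htu htv /eqP lt ncls].
(* The path leaves [t] through a third neighbour [w]; its end differs in class from [u] or from [v],
   and that one is put in front of [t]. *)
have [w] : exists w, w \in [set w in U | h t w] :\: [set u; v].
  apply/set0Pn; rewrite -card_gt0 cardsD subn_gt0.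
  apply: leq_ltn_trans (leq_trans _ (Udeg t tU)); first exact: (subset_leq_card (subsetIr _ _)).
  by rewrite cards2; case: (u == v).
rewrite !inE negb_or => /and3P[/andP[wu wv] wU htw].
have lnbr x : x \in U -> h t x -> lev x = i.
  by move=> xU /andP[_]; rewrite lt; case: (level_cases (Ulev x xU)) => ->; rewrite ?eqxx.
have [|q [pth szq unq qU qZ]] := @path_extend _ h U [set u; v; t] w (k - j.+2).*2 wU.
  move=> x /Udeg; apply: leq_ltn_trans; apply: leq_trans (_ : 3 + (k - j.+2).*2 <= _);
    last by clear -ik; lia.
  by rewrite leq_add2r -setUA cardsU1 cardsU1 cards1; case: (_ \notin _); case: (_ \notin _).
have ext x : x \in U -> h t x -> x != w -> x \notin q -> cls x != cls (last w q) ->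
    exists c, [/\ cycle e c, uniq c & size c = k.*2].
  move=> xU htx xw xq nc; apply: (@samecls [:: t, w & q] x) => //.
  - exact: lnbr.
  - by rewrite /= h_sym htx htw.
  - have tq : t \notin q by apply/negP => /qZ; rewrite !inE eqxx orbT.
    move: unq => /= /andP[-> ->]; rewrite !inE !negb_or xw xq tq /= !andbT; apply/andP; split.
      by apply: contraTneq htx => ->; rewrite /h eqxx andbF.
    by apply: contraTneq htw => <-; rewrite /h eqxx andbF.
  - by move=> y; rewrite !inE => /or3P[/eqP->|/eqP->|/qU].
  - by rewrite /= szq; clear -ik ji; lia.
have [cu|cu] := eqVneq (cls u) (cls (last w q)).
  apply: (ext v) => //; first by rewrite eq_sym.
    by apply/negP => /qZ; rewrite !inE eqxx orbT.
  by rewrite -cu eq_sym.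
apply: (ext u) => //; first by rewrite eq_sym.
by apply/negP => /qZ; rewrite !inE eqxx.
Qed.

End Levels.

(** * The even cycle theorem *)

Section BreadthFirst.
Variables (V : finType) (e : rel V) (c : V -> bool) (r : V) (k : nat).
Hypothesis e_sym : symmetric e.
Hypothesis e_bip : forall x y, e x y -> c x != c y.

Fixpoint ball m : {set V} :=
  if m is m'.+1 then ball m' :|: [set y | [exists x in ball m', e x y]] else [set r].

Lemma ball_mono m n : m <= n -> ball m \subset ball n.
Proof.
move=> /subnKC <-; elim: (n - m) => [|j IH]; first by rewrite addn0.
by rewrite addnS (subset_trans IH) // subsetUl.
Qed.

(* Junk value: vertices outside the ball of radius k + 1 get level k + 2. *)
Definition level v := find (fun m => v \in ball m) (iota 0 k.+2).

Lemma level_le v m : m <= k.+1 -> (level v <= m) = (v \in ball m).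
Proof.
move=> mk; apply/idP/idP => [lm|vm].
  have lk : level v < k.+2 by apply: leq_ltn_trans lm _.
  have hasb : has (fun m => v \in ball m) (iota 0 k.+2) by rewrite has_find size_iota.
  have := nth_find 0 hasb; rewrite -/(level v) nth_iota ?add0n //.
  by apply/subsetP/ball_mono.
rewrite leqNgt; apply/negP => lm; have := before_find 0 lm.
by rewrite nth_iota ?add0n ?vm.
Qed.

Lemma level_root v : level v = 0 -> v = r.
Proof. by move=> lv; have := @level_le v 0 isT; rewrite lv /= inE => /esym/eqP. Qed.

Lemma level_edge u v : e u v -> level u <= k -> level v <= (level u).+1.
Proof.
move=> euv lu; rewrite level_le //= inE; apply/orP; right; rewrite inE.
by apply/exists_inP; exists u; rewrite // -level_le // ltnW.
Qed.

Lemma exists_parent v : 0 < level v <= k.+1 ->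
  exists x, e x v && ((level x).+1 == level v).
Proof.
move=> /andP[]; case lv: (level v) => [//|m] _ mk.
have vm : v \notin ball m by rewrite -level_le ?lv ?ltnn // ltnW.
have : v \in ball m.+1 by rewrite -level_le ?lv.
rewrite /= inE (negbTE vm) inE => /exists_inP[x xm exv]; exists x; rewrite exv /=.
have lx : level x <= m by rewrite level_le // ltnW.
by have := level_edge exv (leq_trans lx mk); rewrite lv eqSS eqn_leq lx ltnS.
Qed.

Definition parent v := odflt v [pick x | e x v && ((level x).+1 == level v)].

Lemma parentP v : 0 < level v <= k.+1 -> e v (parent v) /\ (level (parent v)).+1 = level v.
Proof.
move=> /exists_parent[x hx]; rewrite /parent; case: pickP => [y /andP[]|/(_ x)].
  by rewrite e_sym => ? /eqP.
by rewrite hx.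
Qed.

(** Colours alternate along parent edges; this rules out edges inside a level. *)
Lemma level_color v : level v <= k.+1 -> c v = c r (+) odd (level v).
Proof.
case lv : (level v) => [|m]; first by rewrite (level_root lv) addbF.
elim: m v lv => [|m IH] v lv mk.
  have [|/e_bip cvp] := @parentP v; first by rewrite lv.
  by rewrite lv => -[/level_root pr]; move: cvp; rewrite pr; case: (c v) (c r) => [] [].
have [|/e_bip cvp] := @parentP v; first by rewrite lv.
rewrite lv => -[lp]; move: cvp; rewrite (IH _ lp (ltnW mk)) /=.
by case: (c v) (c r) (odd m) => [] [] [].
Qed.

Lemma level_edge_neq u v : e u v -> level u <= k.+1 -> level u != level v.
Proof.
move=> euv lu; apply/eqP => luv; have := e_bip euv.
by rewrite (level_color lu) (@level_color v) -luv ?eqxx.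
Qed.

Definition layer m := [set v | level v == m].

Lemma layer_disjoint m n : m != n -> [disjoint layer m & layer n].
Proof.
move=> mn; apply/pred0P => v /=; rewrite !inE.
by case: eqP => // ->; apply: negbTE.
Qed.

(** Otherwise the two layers contain a subset of minimum degree above [2 k + 2], and [level_cycle]
    gives a forbidden [2k]-cycle. *)
Lemma layer_edges m : 0 < m < k ->
  ~ (exists s, [/\ cycle e s, uniq s & size s = k.*2]) ->
  \sum_(v in layer m) deg e (layer m.+1) v <= k.*2.+2 * (#|layer m| + #|layer m.+1|).
Proof.
move=> mk nocyc; set U := layer m :|: layer m.+1.
have dis : [disjoint layer m & layer m.+1] by apply: layer_disjoint; rewrite ltn_eqF.
pose h x y := e x y && (level x != level y).
have h_sym : symmetric h by move=> x y; rewrite /h e_sym eq_sym.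
have cardU : #|U| = #|layer m| + #|layer m.+1|.
  by rewrite cardsU (disjoint_setI0 dis) cards0 subn0.
rewrite -leq_double -cardU leqNgt; apply/negP => big.
have [|W [WU Wn Wdeg]] := @min_degree_subset V h U k.*2.+2 h_sym.
  apply: leq_trans big _; rewrite -addnn {2}(sum_degC _ _ e_sym).
  rewrite [leqRHS](_ : _ = \sum_(v in layer m) deg h U v + \sum_(v in layer m.+1) deg h U v);
    last first.
    by rewrite -bigU //; apply: eq_bigl => v; rewrite !inE.
  apply: leq_add; apply: leq_sum => v; rewrite inE => /eqP lv;
    apply/subset_leq_card/subsetP => y; rewrite !inE => /andP[/eqP ly evy].
    by rewrite ly /h evy lv ly eqxx orbT ltn_eqF.
  by rewrite ly /h evy lv ly !eqxx (gtn_eqF (ltnSn m)).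
apply: nocyc; apply: (@level_cycle V e level parent m e_sym _ k W) => //.
- by move=> v lv; apply: parentP; move: mk lv; clear; lia.
- by move=> u v /level_root -> /level_root ->.
- by move=> v /(subsetP WU); rewrite !inE => /orP[]/eqP ->; rewrite !leqnn ?leqnSn.
Qed.

(** Edges from layer [m + 1] go only to its two neighbouring layers. With [L_m] the layer sizes and
    [L_m <= L_(m+1)], dividing by [2 k + 2] gives [(q + 3) L_(m+1) <= (L_m + L_(m+1)) + (L_(m+1) +
    L_(m+2)) <= 3 L_(m+1) + L_(m+2)]. *)
Lemma layer_growth q : 0 < q -> 1 < k ->
  (forall m v, m < k -> v \in layer m -> k.*2.+2 * (q + 3) <= deg e setT v) ->
  ~ (exists s, [/\ cycle e s, uniq s & size s = k.*2]) ->
  q ^ k <= #|layer k|.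
Proof.
move=> q0 k1 mindeg nocyc.
have lr : level r = 0 by apply/eqP; rewrite -leqn0 level_le //= inE.
have l0 : layer 0 = [set r].
  by apply/setP => v; rewrite !inE; apply/eqP/eqP => [/level_root//|->].
suff gen m : m < k -> #|layer m| <= #|layer m.+1| /\ q ^ m.+1 <= #|layer m.+1|.
  by have [] := gen k.-1; rewrite prednK // ltnW.
elim: m => [|m IH] mk.
  have d1 : k.*2.+2 * (q + 3) <= #|layer 1|.
    apply: leq_trans (mindeg 0 r mk _) _; first by rewrite l0 inE.
    apply/subset_leq_card/subsetP => y; rewrite !inE /= => ery.
    have := level_edge ery; have := level_edge_neq ery; rewrite lr; clear; lia.
  by rewrite l0 cards1 expn1; move: d1 q0; clear; nia.
have [IH1 IH2] := IH (ltnW mk).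
(* For [m = 0], [layer_edges] does not apply, but the root alone has at most [#|layer 1|] edges. *)
have back : \sum_(v in layer m) deg e (layer m.+1) v <= k.*2.+2 * (#|layer m| + #|layer m.+1|).
  case: m mk {IH IH1 IH2} => [|m] mk; last by apply: layer_edges => //; apply: ltnW.
  by rewrite l0 big_set1 cards1;
    rewrite mulnDr (leq_trans (deg_le_card _ _ _)) // (leq_trans _ (leq_addl _ _)) // leq_pmull.
have forw := @layer_edges m.+1 mk nocyc.
have split : k.*2.+2 * (q + 3) * #|layer m.+1| <=
    \sum_(v in layer m.+1) deg e (layer m) v + \sum_(v in layer m.+1) deg e (layer m.+2) v.
  rewrite mulnC -sum_nat_const -big_split /=; apply: leq_sum => v vm.
  apply: leq_trans (mindeg _ _ mk vm) _; move: vm; rewrite inE => /eqP lv.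
  rewrite -degU; last by apply: layer_disjoint; rewrite ltn_eqF.
  apply/subset_leq_card/subsetP => y; rewrite !inE /= => evy; rewrite evy andbT.
  have := level_edge evy; have := level_edge_neq evy; rewrite e_sym in evy;
    have := level_edge evy; rewrite lv.
  by move: mk; clear; lia.
rewrite -(sum_degC _ _ e_sym) in split.
have step : q * #|layer m.+1| <= #|layer m.+2|.
  have : k.*2.+2 * (q * #|layer m.+1|) <= k.*2.+2 * #|layer m.+2|; last by rewrite leq_pmul2l.
  by move: split forw back (leq_mul (leqnn k.*2.+2) IH1); clear; nia.
rewrite expnS; split; first by move: step q0; clear; nia.
by apply: leq_trans step; rewrite leq_mul2l IH2 orbT.
Qed.

End BreadthFirst.

Lemma cycle_in (V : finType) (f : rel V) (S : {set V}) s :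
  (forall x y, f x y -> x \in S) -> cycle f s -> {subset s <= S}.
Proof. by move=> fS cs x /(next_cycle cs)/fS. Qed.

(** Without a [2k]-cycle, breadth-first search inside a bipartite subgraph of large minimum degree
    would reach at least [q ^ k] vertices, more than [S] has. *)
Theorem even_cycle_turan (V : finType) (e : rel V) (k q : nat) (S : {set V}) :
  symmetric e -> irreflexive e -> 1 < k -> 0 < q -> #|S| < q ^ k ->
  16 * k.*2.+2 * q * #|S| < \sum_(x in S) deg e S x ->
  exists s, [/\ cycle e s, uniq s, size s = k.*2 & {subset s <= S}].
Proof.
move=> e_sym e_irr k1 q0 cS big.
have [c hc] := max_cut S e_sym e_irr.
pose f x y := e x y && (c x != c y); rewrite -/f in hc.
have f_sym : symmetric f by move=> x y; rewrite /f e_sym eq_sym.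
have [|U [US /set0Pn[r rU] Udeg]] := @min_degree_subset V f S (k.*2.+2 * (q + 3)) f_sym.
  (* The constant 16 is 2 for the cut, 2 for passing to minimum degree, and 4 from
     [q + 3 <= 4 q]. *)
  rewrite -ltn_double; apply: leq_trans hc; apply: leq_ltn_trans big.
  rewrite -!mul2n !mulnA leq_mul2r; apply/orP; right; move: q0; clear; nia.
(* Restricting the edges to [U] keeps every layer inside [U], where the degree bound holds. *)
pose g x y := [&& f x y, x \in U & y \in U].
have g_sym : symmetric g by move=> x y; rewrite /g f_sym; congr (_ && _); rewrite andbC.
have [cyc|nocyc] := boolP [exists s : (k.*2).-tuple V, cycle g s && uniq s].
  have /existsP[s /andP[gs us]] := cyc; exists s; split => //.
  - by apply: sub_cycle gs => x y /andP[/andP[]].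
  - by rewrite size_tuple.
  - by move=> x xs; apply: (subsetP US); move: x xs; apply: cycle_in gs => x y /and3P[].
have nocyc' : ~ exists s, [/\ cycle g s, uniq s & size s = k.*2].
  case=> s [gs us /eqP ss]; case/existsP: nocyc; exists (Tuple ss); by rewrite /= gs.
have gbip x y : g x y -> c x != c y by case/andP => /andP[].
have layerU m v : m <= k -> v \in layer g r k m -> v \in U.
  case: m => [|m] mk; rewrite inE => /eqP lv; first by rewrite (level_root lv).
  by have [|/and3P[_ ? _] _] := @parentP V g r k g_sym v; rewrite ?lv //=; apply: ltnW.
suff mindeg m v : m < k -> v \in layer g r k m -> k.*2.+2 * (q + 3) <= deg g setT v.
  have := @layer_growth V g c r k g_sym gbip q q0 k1 mindeg nocyc'.
  rewrite leqNgt (leq_ltn_trans _ cS) //.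
  by apply/subset_leq_card/subsetP => v /layerU vU; apply: (subsetP US); exact: vU.
move=> /ltnW mk /(layerU _ _ mk) vU.
apply: leq_trans (ltnW (Udeg v vU)) _; apply/subset_leq_card/subsetP => y.
by rewrite !inE /g vU /= => /andP[-> ->].
Qed.

(** * Disjoint even cycles *)

Lemma subset_of_card (V : finType) (S : {set V}) m : m <= #|S| ->
  exists2 U : {set V}, U \subset S & #|U| = m.
Proof.
move=> mS; exists [set x in take m (enum S)].
  by apply/subsetP => x; rewrite inE => /mem_take; rewrite mem_enum.
by rewrite cardsE (card_uniqP _) ?take_uniq ?enum_uniq // size_takel // -cardE.
Qed.

Section CycleFamilies.
Variables (V : finType) (e : rel V).
Implicit Types (S U : {set V}) (ks : seq nat).

(** Uniqueness of the concatenation encodes both that each cycle is simple and that the cycles are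
    disjoint. *)
Definition has_cycles S ks := exists cs : seq (seq V),
  [/\ map size cs = map double ks, all (cycle e) cs, uniq (flatten cs) & {subset flatten cs <= S}].

Lemma has_cycles_subset S U ks : S \subset U -> has_cycles S ks -> has_cycles U ks.
Proof.
by move=> /subsetP SU [cs [? ? ? sub]]; exists cs; split=> // x /sub /SU.
Qed.

Lemma has_cycles_cons S k ks s : cycle e s -> uniq s -> size s = k.*2 -> {subset s <= S} ->
  has_cycles (S :\: [set x in s]) ks -> has_cycles S (k :: ks).
Proof.
move=> cs us ss sS [l [sl cl ul lS]]; exists (s :: l); split=> /=.
- by rewrite ss sl.
- by rewrite cs.
- rewrite cat_uniq us ul andbT; apply/hasPn => x /lS; rewrite !inE.
  by case/andP.
- by move=> x; rewrite mem_cat => /orP[/sS//|/lS]; rewrite inE => /andP[].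
Qed.

Lemma has_cycles_rcons S k ks s : cycle e s -> uniq s -> size s = k.*2 -> {subset s <= S} ->
  has_cycles (S :\: [set x in s]) ks -> has_cycles S (rcons ks k).
Proof.
move=> cs us ss sS [l [sl cl ul lS]]; exists (rcons l s); split.
- by rewrite !map_rcons ss sl.
- by rewrite all_rcons cs.
- rewrite flatten_rcons cat_uniq us ul andbT; apply/hasPn => x xs.
  by apply/negP => /lS; rewrite !inE xs.
- by move=> x; rewrite flatten_rcons mem_cat => /orP[/lS|/sS//]; rewrite inE => /andP[].
Qed.

Hypotheses (e_sym : symmetric e) (e_irr : irreflexive e).

Lemma sum_deg_setD S U :
  \sum_(x in S) deg e S x <= \sum_(x in S :\: U) deg e (S :\: U) x + 2 * #|U| * #|S|.
Proof.
have degD x : deg e S x <= deg e (S :\: U) x + #|U|.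
  rewrite /deg -(cardsID U); rewrite addnC leq_add //; apply/subset_leq_card/subsetP => y;
    rewrite !inE.
    by case/andP => -> /andP[-> ->].
  by case/andP.
rewrite (big_setID U) /= addnC mul2n -addnn mulnDl addnA; apply: leq_add.
  apply: leq_trans (_ : \sum_(x in S :\: U) (deg e (S :\: U) x + #|U|) <= _).
    exact: leq_sum.
  rewrite big_split leq_add2l sum_nat_const mulnC leq_mul2l subset_leq_card ?orbT //.
  exact: subsetDl.
apply: leq_trans (_ : \sum_(x in S :&: U) #|S| <= _).
  by apply: leq_sum => x _; apply: deg_le_card.
by rewrite sum_nat_const leq_mul2r subset_leq_card ?orbT // subsetIr.
Qed.

Definition turan_const ks := 16 * \sum_(k <- ks) k.*2.+2.

(** Greedy: deleting a [2k]-cycle costs at most [4 k #|S|] of the degree sum, no more than the share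
    of [k] in [turan_const]. As [k0] is a lower bound for all [k], one [q] serves every cycle. *)
Lemma has_cycles_turan k0 q S ks : 1 < k0 -> all (leq k0) ks -> 0 < q ->
  #|S| < q ^ k0 -> turan_const ks * q * #|S| < \sum_(x in S) deg e S x ->
  has_cycles S ks.
Proof.
rewrite /turan_const => k1 + q0; elim: ks S => [|k ks IH] S /=.
  by move=> _ _ _; exists [::]; split.
case/andP => k0k k0ks cS; rewrite big_cons => big.
have [|||s [cs us ss sS]] := @even_cycle_turan V e k q S e_sym e_irr _ q0.
- exact: leq_trans k0k.
- by apply: leq_trans cS _; rewrite leq_pexp2l.
- apply: leq_ltn_trans big; rewrite mulnDr !mulnDl; exact: leq_addr.
apply: (has_cycles_cons cs us ss sS); apply: IH => //.
  by apply: leq_ltn_trans cS; apply/subset_leq_card/subsetDl.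
have := sum_deg_setD S [set x in s]; rewrite cardsE (card_uniqP us) ss => loss.
have le_SD : #|S :\: [set x in s]| <= #|S| by apply/subset_leq_card/subsetDl.
rewrite -(ltn_add2r (2 * k.*2 * #|S|)); apply: leq_trans loss; apply: leq_ltn_trans big.
rewrite mulnDr 2!mulnDl addnC; apply: leq_add; last by rewrite leq_mul2l le_SD orbT.
by rewrite leq_mul2r; apply/orP; right; move: q0; clear; nia.
Qed.

(* Z is cut into blocks of size #|B|, to each of which has_cycles_turan applies
   together with B. *)
Lemma unbalanced_turan k0 q S ks (B Z : {set V}) : 1 < k0 -> all (leq k0) ks -> 0 < q ->
  ~ has_cycles S ks -> B \subset S -> Z \subset S -> 0 < #|B| -> #|B|.*2 < q ^ k0 ->
  \sum_(z in Z) deg e B z <= 2 * turan_const ks * q * (#|Z| + #|B|).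
Proof.
move=> k1 k0ks q0 nocyc BS + B0 Bq; have [n] := ubnP #|Z|; elim: n Z => // n IH Z leZn ZS.
have small (W : {set V}) : W \subset S -> #|W| <= #|B| ->
    \sum_(z in W) deg e B z <= 2 * turan_const ks * q * #|B|.
  move=> WS WB; have cU : #|W :|: B| <= #|B|.*2.
    by rewrite cardsU -addnn; apply: leq_trans (leq_subr _ _) _; rewrite leq_add2r.
  apply: leq_trans (_ : \sum_(z in W :|: B) deg e (W :|: B) z <= _).
    rewrite [leqRHS](big_setID W) /= setUK; apply: leq_trans (leq_addr _ _).
    by apply: leq_sum => z _; apply/deg_subset/subsetUr.
  apply: leq_trans (_ : turan_const ks * q * #|W :|: B| <= _).
    rewrite leqNgt; apply/negP => big; apply: nocyc.
    apply: (@has_cycles_subset (W :|: B)); first by rewrite subUset WS BS.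
    by apply: (has_cycles_turan (k0 := k0) (q := q)) => //; apply: leq_ltn_trans cU Bq.
  by apply: leq_trans (leq_mul (leqnn _) cU) _; rewrite -mul2n !mulnA [_ * 2]mulnC !mulnA.
have [ZB|BZ] := leqP #|Z| #|B|.
  by apply: leq_trans (small Z ZS ZB) _; rewrite leq_mul2l leq_addl orbT.
have [W WZ cW] := subset_of_card (ltnW BZ).
rewrite (big_setID W) /= (setIidPr WZ) -(cardsID W Z) (setIidPr WZ) cW -addnA mulnDr.
apply: leq_add; first by apply: small; rewrite ?cW //; apply: subset_trans ZS.
apply: IH; last by apply: subset_trans ZS; apply: subsetDl.
by move: leZn; rewrite cardsD (setIidPr WZ) cW; move: B0 BZ; clear; lia.
Qed.

(** Counting edges from the side of [S] puts [unbalanced_turan] to use. For [q] of order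
    [#|B| ^ (1 / k0)], the average degree in [B] is then at most of order
    [#|S| #|B| ^ (1 / k0 - 1)]. *)
Lemma sum_deg_bound k0 q S ks (B : {set V}) : 1 < k0 -> all (leq k0) ks -> 0 < q ->
  ~ has_cycles S ks -> B \subset S -> 0 < #|B| -> #|B|.*2 < q ^ k0 ->
  \sum_(z in B) deg e S z <= 4 * turan_const ks * q * #|S|.
Proof.
move=> k1 k0ks q0 nocyc BS B0 Bq; rewrite (sum_degC _ _ e_sym).
apply: leq_trans (unbalanced_turan k1 k0ks q0 nocyc BS (subxx S) B0 Bq) _.
apply: leq_trans (_ : 2 * turan_const ks * q * (#|S| + #|S|) <= _).
  by rewrite leq_mul2l leq_add2l subset_leq_card ?orbT.
by rewrite addnn -mul2n mulnCA !mulnA.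
Qed.

End CycleFamilies.

(** * Degree powers *)

Section DegreePowers.
Local Open Scope ring_scope.
Variable R : realType.
Implicit Types (p s x y : R).

Lemma ler_pow x y p : 0 <= p -> 0 <= x -> x <= y -> x `^ p <= y `^ p.
Proof. by move=> p0 x0 xy; apply: ge0_ler_powR; rewrite // nnegrE // (le_trans x0). Qed.

(** Replaces the comparison of the sum of [m ^ (- (1 + s))] with an integral; it follows from
    [ln (m - 1) <= ln m - 1 / m] and [exp x >= 1 + x]. *)
Lemma powR_telescope (s : R) (m : nat) : 0 < s -> (1 < m)%N ->
  s * m%:R `^ (- (1 + s)) <= m.-1%:R `^ (- s) - m%:R `^ (- s).
Proof.
move=> s0 m1; have mgt0 : (0 : R) < m%:R by rewrite ltr0n ltnW.
have m'gt0 : (0 : R) < m.-1%:R by rewrite ltr0n; move: m1; clear; lia.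
have m1r : (1 : R) < m%:R by rewrite ltr1n.
have predm : m.-1%:R = m%:R * (1 + - m%:R^-1) :> R.
  by rewrite -subn1 natrB 1?ltnW // mulrDr mulr1 mulrN mulfV ?gt_eqF.
have inv1 : m%:R^-1 < 1 :> R by rewrite invf_lt1.
have lnm : ln m.-1%:R <= ln m%:R - m%:R^-1 :> R.
  rewrite predm lnM ?posrE ?lerD2l ?le_ln1Dx //; lra.
have lower : m%:R `^ (- s) * (1 + s / m%:R) <= m.-1%:R `^ (- s).
  rewrite /powR !gt_eqF //; apply: le_trans (_ : expR (- s * ln m%:R) * expR (s / m%:R) <= _).
    by rewrite ler_wpM2l ?expR_ge0 ?expR_ge1Dx.
  rewrite -expRD ler_expR; have := ler_wpM2l (ltW s0) lnm; rewrite mulrBr; lra.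
have -> : s * m%:R `^ (- (1 + s)) = m%:R `^ (- s) * (s / m%:R).
  by rewrite opprD powRD ?(gt_eqF mgt0) ?implybT // powR_inv1 ?ltW //; ring.
by move: lower; rewrite mulrDr mulr1; lra.
Qed.

Lemma exists_root_bound (m k : nat) : (0 < m)%N -> (0 < k)%N ->
  exists q, [/\ (0 < q)%N, (m.*2 < q ^ k)%N & q%:R <= 4 * m%:R `^ k%:R^-1 :> R].
Proof.
move=> m0 k0; have kpos : (0 : R) < k%:R by rewrite ltr0n.
have kinv : 0 <= k%:R^-1 :> R by rewrite invr_ge0 ltW.
have kinv1 : k%:R^-1 <= 1 :> R by rewrite invf_le1 // ler1n.
set a : R := (m.*2)%:R `^ k%:R^-1.
have a1 : 1 <= a.
  by rewrite -[leLHS](powRr0 (m.*2)%:R) ler_powR // ler1n double_gt0.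
(* [q <= a + 1 <= 2 a], and [a <= 2 m ^ (1 / k)], which yields the factor 4. *)
exists (Num.truncn a).+1; split=> //.
  rewrite -(ltr_nat R) natrX -powR_mulrn //.
  have -> : (m.*2)%:R = a `^ k%:R :> R by rewrite /a -powRrM mulVf ?gt_eqF // powRr1.
  by apply: gt0_ltr_powR; rewrite ?nnegrE ?powR_ge0 // truncnS_gt.
have ta : (Num.truncn a)%:R <= a by rewrite truncn_le powR_ge0.
have a2 : a <= 2 * m%:R `^ k%:R^-1.
  rewrite /a -mul2n natrM powRM // ler_wpM2r ?powR_ge0 //.
  by rewrite -[leRHS]powRr1 // ler_powR // ler1n.
by rewrite -natr1; lra.
Qed.

Lemma exponent_gt1 p (k : nat) : (1 < k)%N -> k%:R / (k%:R - 1) < p -> 1 < p.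
Proof.
move=> k1; apply: le_lt_trans; have k1R : (1 : R) < k%:R by rewrite ltr1n.
by rewrite ler_pdivlMr; lra.
Qed.

(** With an [m]-th largest degree of order [n m ^ (1 / k - 1)], its [p]-th power is of order
    [n ^ p m ^ (- (1 + s))] for this [s]; summed over [m], this converges exactly when
    [p > k / (k - 1)]. *)
Definition tail_exponent p (k : nat) : R := p * (1 - k%:R^-1) - 1.

Lemma tail_exponent_gt0 p k : (1 < k)%N -> k%:R / (k%:R - 1) < p -> 0 < tail_exponent p k.
Proof.
move=> k1; have k1R : (1 : R) < k%:R by rewrite ltr1n.
rewrite ltr_pdivrMr ?subr_gt0 // => hp.
rewrite -(ltr_pM2r (x := k%:R)) ?mul1r; last by lra.
rewrite -mulrA mulrBl mul1r mulVf // gt_eqF //; lra.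
Qed.

(** The 16 is 4 from [sum_deg_bound] times 4 from [exists_root_bound]; the division comes from
    [powR_telescope]. *)
Definition tail_const p k ks : R := (16 * (turan_const ks)%:R) `^ p / tail_exponent p k.

Lemma tail_const_ge0 p k ks : 0 < tail_exponent p k -> 0 <= tail_const p k ks.
Proof. by move=> s0; rewrite divr_ge0 ?powR_ge0 ?ltW. Qed.

Section Graph.
Variables (V : finType) (e : rel V) (k : nat) (ks : seq nat) (p : R).
Hypotheses (e_sym : symmetric e) (e_irr : irreflexive e).
Hypotheses (k1 : (1 < k)%N) (k_ks : all (leq k) ks) (hp : k%:R / (k%:R - 1) < p).
Implicit Types S U : {set V}.

Let s := tail_exponent p k.
Let s0 : 0 < s. Proof. exact: tail_exponent_gt0. Qed.
Let p1 : 1 < p. Proof. exact: exponent_gt1 hp. Qed.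
Let p0 : 0 <= p. Proof. by have := p1; lra. Qed.

(** The minimum degree in [U] is at most the average, which [sum_deg_bound] controls with [q] from
    [exists_root_bound]. *)
Lemma min_degree_power S U : ~ has_cycles e S ks -> U \subset S -> U != set0 ->
  exists2 v, v \in U & (deg e S v)%:R `^ p <=
    (16 * (turan_const ks)%:R) `^ p * #|S|%:R `^ p * #|U|%:R `^ (- (1 + s)).
Proof.
move=> nocyc US /set0Pn[u uU].
case: (@arg_minnP _ u (mem U) (deg e S) uU) => v vU vmin; exists v => //.
have U0 : (0 < #|U|)%N by apply/card_gt0P; exists u.
have U0R : (0 : R) < #|U|%:R by rewrite ltr0n.
have [q [q0 Uq q4]] := exists_root_bound U0 (ltnW k1).
have bound := sum_deg_bound e_sym e_irr k1 k_ks q0 nocyc US U0 Uq.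
have {}bound : (#|U| * deg e S v <= 4 * turan_const ks * q * #|S|)%N.
  apply: leq_trans bound; rewrite -sum_nat_const; apply: leq_sum => w wU; exact: vmin.
move: (turan_const ks) bound => C bound.
have dle : (deg e S v)%:R <= 16 * C%:R * #|S|%:R * #|U|%:R `^ (k%:R^-1 - 1) :> R.
  rewrite powRB ?(gt_eqF U0R) ?implybT // (powRr1 (ltW U0R)) !mulrA ler_pdivlMr // mulrC.
  move: bound; rewrite -(ler_nat R) !natrM => /le_trans; apply.
  have -> : 16 * C%:R * #|S|%:R * #|U|%:R `^ k%:R^-1 =
    4 * C%:R * (4 * #|U|%:R `^ k%:R^-1) * #|S|%:R :> R by ring.
  by rewrite ler_wpM2r // ler_wpM2l ?mulr_ge0.
apply: le_trans (ler_pow p0 (ler0n _ _) dle) _.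
rewrite powRM ?mulr_ge0 ?powR_ge0 // powRM ?mulr_ge0 // -powRrM.
rewrite le_eqVlt; apply/orP; left; apply/eqP; congr (_ * _ `^ _).
by rewrite /s /tail_exponent; ring.
Qed.

(** Vertices of minimum degree are removed one at a time until [M] remain; the removed powers are
    bounded by a telescoping series. *)
Lemma degree_power_tail S U M : ~ has_cycles e S ks -> U \subset S -> (0 < M <= #|U|)%N ->
  exists U0, [/\ U0 \subset U, #|U0| = M &
    \sum_(v in U) (deg e S v)%:R `^ p <= \sum_(v in U0) (deg e S v)%:R `^ p
      + tail_const p k ks * #|S|%:R `^ p * M%:R `^ (- s)].
Proof.
move=> nocyc US /andP[M0 MU].
pose c := tail_const p k ks * #|S|%:R `^ p.
have c0 : 0 <= c by rewrite mulr_ge0 ?powR_ge0 // tail_const_ge0.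
(* The induction needs the exact telescoping error, with the term at [#|U|] subtracted. *)
suff : exists U0, [/\ U0 \subset U, #|U0| = M &
    \sum_(v in U) (deg e S v)%:R `^ p <= \sum_(v in U0) (deg e S v)%:R `^ p
      + c * (M%:R `^ (- s) - #|U|%:R `^ (- s))].
  case=> U0 [? ? le]; exists U0; split=> //; apply: le_trans le _.
  by rewrite lerD2l ler_wpM2l // gerBl powR_ge0.
have [n] := ubnP #|U|; elim: n U US MU => // n IH U US MU leUn.
have [UM|UM] := eqVneq #|U| M.
  by exists U; split=> //; rewrite UM subrr mulr0 addr0.
have ltMU : (M < #|U|)%N by rewrite ltn_neqAle eq_sym UM.
have [|v vU dv] := min_degree_power nocyc US.
  by rewrite -card_gt0 (leq_trans M0).
have cU : #|U| = #|U :\ v|.+1 by rewrite (cardsD1 v) vU.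
have [|||U0 [U0U cU0 le]] := IH (U :\ v).
- by apply: subset_trans US; apply: subD1set.
- by move: ltMU; rewrite cU ltnS.
- by move: leUn; rewrite cU.
exists U0; split=> //; first by apply: subset_trans U0U (subD1set _ _).
rewrite (big_setD1 v vU) /=.
have tel := @powR_telescope s #|U| s0 (leq_ltn_trans M0 ltMU).
have {}dv : (deg e S v)%:R `^ p <= c * (s * #|U|%:R `^ (- (1 + s))).
  apply: le_trans dv _; rewrite /c /tail_const -/s.
  rewrite le_eqVlt; apply/orP; left; apply/eqP; field; by rewrite gt_eqF.
have := ler_wpM2l c0 tel; rewrite {2}cU /= => tel'.
rewrite !mulrBr in tel' le *; lra.
Qed.

Lemma degree_power_bound S U : ~ has_cycles e S ks -> U \subset S ->
  \sum_(v in U) (deg e S v)%:R `^ p <= (1 + tail_const p k ks) * #|S|%:R `^ p.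
Proof.
move=> nocyc US; have [->|Un] := eqVneq U set0.
  by rewrite big_set0 mulr_ge0 ?powR_ge0 // addr_ge0 // tail_const_ge0.
have [|U0 [_ /eqP/cards1P[x ->] le]] := @degree_power_tail S U 1 nocyc US.
  by rewrite card_gt0.
apply: le_trans le _; rewrite big_set1 powR1 mulr1 mulrDl mul1r lerD2r.
by apply: ler_pow => //; rewrite ler_nat deg_le_card.
Qed.

End Graph.
End DegreePowers.

(** * Completing cycles through hubs *)

Section Zigzag.
Variables (V : finType) (e : rel V).
Hypotheses (e_sym : symmetric e) (e_irr : irreflexive e).
Implicit Types (A X : {set V}) (hs ys : seq V) (ks : seq nat).

Fixpoint zigzag hs ys : seq V :=
  match hs, ys with
  | h :: hs', y :: ys' => h :: y :: zigzag hs' ys'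
  | _, _ => [::]
  end.

Lemma size_zigzag hs ys : size hs = size ys -> size (zigzag hs ys) = (size hs).*2.
Proof. by elim: hs ys => [|h hs IH] [|y ys] //= [/IH->]. Qed.

Lemma count_zigzag (a : pred V) hs ys : size hs = size ys ->
  count a (zigzag hs ys) = count a hs + count a ys.
Proof.
elim: hs ys => [|h hs IH] [|y ys] //= [/IH->]; rewrite -!addnA; congr (_ + _).
by rewrite addnCA.
Qed.

Lemma mem_zigzag hs ys : size hs = size ys -> zigzag hs ys =i hs ++ ys.
Proof.
by move=> sz; apply/perm_mem/permP => a; rewrite count_zigzag // count_cat.
Qed.

Lemma last_zigzag x hs ys : size hs = size ys -> last x (zigzag hs ys) = last x ys.
Proof. by elim: hs ys x => [|h hs IH] [|y ys] x //= [/IH->]. Qed.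

Lemma path_zigzag x hs ys : size hs = size ys ->
  {in hs & x :: ys, forall h y, e h y} -> path e x (zigzag hs ys).
Proof.
elim: hs ys x => [|h hs IH] [|y ys] x //= [sz] com.
have ehx : e h x by apply: com; rewrite mem_head.
have ehy : e h y by apply: com; rewrite !inE eqxx ?orbT.
rewrite e_sym ehx ehy /=; apply: IH => // h' y' h'h y'y.
by apply: com; rewrite inE ?h'h ?y'y orbT.
Qed.

Lemma complete_has_cycles hs ys ks : size hs = sumn ks -> size ys = sumn ks ->
  uniq (hs ++ ys) -> {in hs & ys, forall h y, e h y} ->
  has_cycles e [set x in hs ++ ys] ks.
Proof.
elim: ks hs ys => [|k ks IH] hs ys /=; first by exists [::]; split.
move=> sh sy un com; have kh : k <= size hs by rewrite sh leq_addr.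
have ky : k <= size ys by rewrite sy leq_addr.
have sz : size (take k hs) = size (take k ys) by rewrite !size_takel.
set s := zigzag (take k hs) (take k ys).
have un' : uniq (s ++ (drop k hs ++ drop k ys)).
  rewrite (perm_uniq (s2 := hs ++ ys)) //; apply/permP => a.
  rewrite -[in RHS](cat_take_drop k hs) -[in RHS](cat_take_drop k ys) !count_cat count_zigzag //.
  by rewrite !addnA; congr (_ + _); rewrite addnAC.
have mem_s x : x \in s -> x \in hs ++ ys.
  by rewrite mem_zigzag // !mem_cat => /orP[] /mem_take ->; rewrite ?orbT.
apply: (@has_cycles_cons _ _ _ k ks s).
- rewrite /s; case Eh: (take k hs) sz => [|h hs'] //; case Ey: (take k ys) => [|y ys'] //= [sz].
  have hhs z : z \in h :: hs' -> z \in hs by rewrite -Eh => /mem_take.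
  have yys z : z \in y :: ys' -> z \in ys by rewrite -Ey => /mem_take.
  have hys z : z \in y :: ys' -> e h z by move=> /yys; apply: com; rewrite hhs ?mem_head.
  rewrite rcons_path last_zigzag // [e _ h]e_sym !hys ?mem_head ?mem_last // andbT /=.
  apply: path_zigzag => // h' y' h'h /yys; apply: com.
  by apply: hhs; rewrite inE h'h orbT.
- by move: un'; rewrite cat_uniq => /and3P[].
- by rewrite size_zigzag // size_takel.
- by move=> x /mem_s; rewrite inE.
apply: (has_cycles_subset (S := [set x in drop k hs ++ drop k ys])).
  apply/subsetP => x; rewrite !inE => xd; apply/andP; split.
    by move: un'; rewrite cat_uniq => /and3P[_ /hasPn/(_ x xd)].
  by move: xd; rewrite !mem_cat => /orP[] /mem_drop ->; rewrite ?orbT.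
apply: IH; rewrite ?size_drop ?sh ?sy ?addKn //.
  by move: un'; rewrite cat_uniq => /and3P[].
by move=> h y /mem_drop ? /mem_drop ?; apply: com.
Qed.

Lemma split_list (X : {set V}) m n : m + n <= #|X| ->
  exists l1 l2, [/\ size l1 = m, size l2 = n, uniq (l1 ++ l2) & {subset l1 ++ l2 <= X}].
Proof.
move=> mn; have [U UX cU] := subset_of_card mn.
exists (take m (enum U)), (drop m (enum U)).
rewrite size_takel ?size_drop -?cardE ?cU ?addKn ?leq_addr // cat_take_drop enum_uniq.
by split=> // x; rewrite mem_enum; apply: (subsetP UX).
Qed.

Lemma complete_set_has_cycles A X ks : {in A & X, forall a x, e a x} ->
  sumn ks <= #|A| -> sumn ks <= #|X| -> has_cycles e setT ks.
Proof.
move=> com cA cX.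
have [|hs [? [sh _]]] := @split_list A (sumn ks) 0; first by rewrite addn0.
rewrite cat_uniq => /and3P[uh _ _] hA.
have [|ys [? [sy _]]] := @split_list X (sumn ks) 0; first by rewrite addn0.
rewrite cat_uniq => /and3P[uy _ _] yX.
have {}hA x : x \in hs -> x \in A by move=> xh; apply: hA; rewrite mem_cat xh.
have {}yX x : x \in ys -> x \in X by move=> xh; apply: yX; rewrite mem_cat xh.
apply: has_cycles_subset (subsetT _) (complete_has_cycles sh sy _ _).
  rewrite cat_uniq uh uy andbT; apply/hasPn => x /yX xX; apply/negP => /hA xA.
  by have := com _ _ xA xX; rewrite e_irr.
by move=> h y /hA hA' /yX yX'; apply: com.
Qed.

Section Completion.
Variables (A X : {set V}).
Hypothesis com : {in A & X, forall a x, e a x}.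

Let disAX x : x \in A -> x \in X -> False.
Proof. by move=> xA xX; have := com xA xX; rewrite e_irr. Qed.

(* Splits the hubs A and the set X minus the special vertices L between a
   special cycle and the remaining cycles of the family. *)
Lemma split_hubs (L : seq V) ks m n : uniq L -> (forall x, x \in L -> x \notin A) ->
  m + sumn ks <= #|A| -> n + sumn ks + size L <= #|X| ->
  exists hs ys, [/\ size hs = m, size ys = n, {subset hs <= A} /\ {subset ys <= X},
    uniq (L ++ hs ++ ys) & forall s : seq V, s =i L ++ hs ++ ys -> has_cycles e (setT :\: [set x in s]) ks].
Proof.
move=> uL LA cA cX; have [hs [hs' [sh sh' uh hA]]] := split_list cA.
have [|ys [ys' [sy sy' uy yX]]] := @split_list (X :\: [set x in L]) n (sumn ks).
  rewrite cardsD leq_subRL; last by apply: subset_leq_card (subsetIl _ _).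
  apply: leq_trans cX; rewrite addnC leq_add2l;
    apply: leq_trans (subset_leq_card (subsetIr _ _)) _.
  by rewrite cardsE card_size.
have {}yX x : x \in ys ++ ys' -> x \in X /\ x \notin L.
  by move=> /yX; rewrite !inE => /andP[].
have all_uniq : uniq ((L ++ hs ++ ys) ++ (hs' ++ ys')).
  rewrite (perm_uniq (s2 := L ++ ((hs ++ hs') ++ (ys ++ ys')))); last first.
    apply/permP => a; rewrite !count_cat -!addnA; congr (_ + (_ + _)).
    by rewrite addnCA.
  rewrite cat_uniq uL cat_uniq uh uy /= andbT; apply/andP; split; apply/hasPn => x.
    rewrite mem_cat => /orP[/hA xA|/yX[]//]; apply/negP => /LA.
    by rewrite xA.
  by move=> /yX[xX _]; apply/negP => /hA /disAX; apply.
exists hs, ys; split=> //.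
- split=> x xh; first by apply: hA; rewrite mem_cat xh.
  by have [] := yX x; rewrite ?mem_cat ?xh.
- by move: all_uniq; rewrite cat_uniq => /and3P[].
move=> s s_eq; apply: (has_cycles_subset (S := [set x in hs' ++ ys'])).
  apply/subsetP => x; rewrite inE => xd; rewrite !inE andbT s_eq.
  by move: all_uniq; rewrite cat_uniq => /and3P[_ /hasPn/(_ x xd)].
apply: complete_has_cycles => //; first by move: all_uniq; rewrite cat_uniq => /and3P[].
move=> h y hh yy; apply: com; first by apply: hA; rewrite mem_cat hh orbT.
by have [] := yX y; rewrite ?mem_cat ?yy ?orbT.
Qed.

(** The path [x1 w x2] replaces a passage through a hub, so this cycle needs only [k - 1] hubs and
    the whole family one hub less. *)
Lemma cherry_has_cycles k ks w x1 x2 : 1 < k -> k + sumn ks <= #|A|.+1 ->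
  k + sumn ks < #|X| -> w \notin A -> x1 \in X -> x2 \in X -> x1 != x2 ->
  e w x1 -> e w x2 -> has_cycles e setT (k :: ks).
Proof.
move=> k1 cA cX wA x1X x2X x12 ew1 ew2.
have [||||hs [ys [sh sy [hA yX] un rest]]] := @split_hubs [:: w; x2; x1] ks k.-1 k.-2.
- rewrite /= !inE negb_or andbT [x2 == _]eq_sym x12 andbT.
  by apply/andP; split; [apply: contraTneq ew2|apply: contraTneq ew1] => ->; rewrite e_irr.
- move=> x; rewrite !inE => /or3P[] /eqP-> //; apply/negP => /disAX; exact.
- by move: cA k1; clear; lia.
- by rewrite /=; move: cX k1; clear; lia.
have sz : size hs = size (rcons ys x1) by rewrite size_rcons sh sy; move: k1; clear; lia.
(* The cycle alternates [k - 1] hubs with [k - 2] further vertices of [X] between [x2] and [x1], and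
   closes through [w]. *)
set s := w :: x2 :: zigzag hs (rcons ys x1).
have perm_s : perm_eq s ([:: w; x2; x1] ++ hs ++ ys).
  apply/permP => a; rewrite /= count_zigzag // -cats1 !count_cat /=.
  by move: (a w) (a x1) (a x2) => b0 b1 b2; clear; lia.
apply: (@has_cycles_cons _ _ _ _ _ s) (rest _ (perm_mem perm_s)).
- rewrite /s /= rcons_path last_zigzag // last_rcons [e x1 w]e_sym ew2 ew1 andbT.
  apply: path_zigzag => // h y /hA hA'; rewrite inE mem_rcons inE => hy; apply: com => //.
  by case/or3P: hy => [/eqP->|/eqP->|/yX].
- by rewrite (perm_uniq perm_s).
- by rewrite /= size_zigzag // sh; move: k1; clear; lia.
- by move=> x _; rewrite inE.
Qed.

(** A [2k]-cycle containing both edges needs only [k - 1] hubs, one less than half its length. The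
    special cycle is appended last because the largest [k] ends the sorted list. *)
Lemma two_edges_has_cycles k ks x1 x2 x3 x4 : 2 < k -> k + sumn ks <= #|A|.+1 ->
  k + sumn ks < #|X| -> {subset [:: x1; x2; x3; x4] <= X} -> uniq [:: x1; x2; x3; x4] ->
  e x1 x2 -> e x3 x4 -> has_cycles e setT (rcons ks k).
Proof.
move=> k2 cA cX LX uL e12 e34.
have [||||hs0 [ys [sh sy [hA yX] un rest]]] := @split_hubs [:: x1; x2; x3; x4] ks k.-1 (k - 3).
- exact: uL.
- move=> x /LX xX; apply/negP => /disAX; exact.
- by move: cA k2; clear; lia.
- by rewrite /=; move: cX k2; clear; lia.
case: hs0 sh hA un rest => [|h hs] sh hA un rest; first by move: k2 sh => /=; clear; lia.
have sz : size hs = size (rcons ys x1) by move: sh; rewrite /= size_rcons sy; move: k2; clear;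
  lia.
(* The hub [h] links the two edges; [x4] returns to [x1] through [k - 2] hubs and [k - 3] vertices
   of [X], hence [2 < k]. *)
set s := [:: x2, h, x3, x4 & zigzag hs (rcons ys x1)].
have perm_s : perm_eq s ([:: x1; x2; x3; x4] ++ (h :: hs) ++ ys).
  apply/permP => a; rewrite /= count_zigzag // -cats1 !count_cat /=.
  by move: (a h) (a x1) (a x2) (a x3) (a x4) => b0 b1 b2 b3 b4; clear; lia.
have hh : h \in A by apply: hA; rewrite mem_head.
apply: (@has_cycles_rcons _ _ _ _ _ s) (rest _ (perm_mem perm_s)).
- rewrite /s /= rcons_path last_zigzag // last_rcons e12 e34 andbT.
  rewrite e_sym !com ?LX ?inE ?eqxx ?orbT //=.
  apply: path_zigzag => // h' y h'h; rewrite inE mem_rcons inE => hy; apply: com => //.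
    by apply: hA; rewrite inE h'h orbT.
  by case/or3P: hy => [/eqP->|/eqP->|/yX //]; apply: LX; rewrite !inE eqxx ?orbT.
- by rewrite (perm_uniq perm_s).
- by rewrite /= size_zigzag //; move: sh k2; rewrite /=; clear; lia.
- by move=> x _; rewrite inE.
Qed.

End Completion.
End Zigzag.

(** * Existence of the hubs *)

(** Vertices with at least [b] neighbours in [U] are grouped by their neighbourhood; more than [b]
    in one group would give a [K_(b,b)]. All others contribute at most [b - 1] each. *)
Lemma sum_deg_small_set (V : finType) (e : rel V) (ks : seq nat) (U : {set V}) :
  symmetric e -> irreflexive e -> ~ has_cycles e setT ks -> 0 < sumn ks ->
  \sum_(v in U) deg e setT v <= (sumn ks).-1 * #|V| + 2 ^ #|U| * sumn ks * #|U|.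
Proof.
move=> e_sym e_irr nocyc b0; set b := sumn ks.
pose N w := [set v in U | e w v].
pose bad := [set w | b <= #|N w|].
rewrite (sum_degC _ _ e_sym) -cardsT.
have card_bad : #|bad| <= 2 ^ #|U| * b.
  rewrite -sum1_card (partition_big N (mem (powerset U))) /=; last first.
    by move=> w _; rewrite powersetE; apply/subsetP => v; rewrite inE => /andP[].
  rewrite -card_powerset -sum_nat_const; apply: leq_sum => Q _; rewrite sum1dep_card.
  set F := [set w | _]; rewrite leqNgt; apply/negP => cF.
  have [|[w]] := set_0Vmem F; first by move=> F0; rewrite F0 cards0 in cF.
  rewrite !inE => /andP[bw /eqP Nw]; apply: nocyc.
  apply: (@complete_set_has_cycles _ _ e_sym e_irr Q F); last exact: ltnW.
    move=> v z vQ; rewrite !inE => /andP[_ /eqP Nz]; move: vQ; rewrite -Nz inE.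
    by case/andP=> _; rewrite e_sym.
  by rewrite -Nw; exact: bw.
rewrite (big_setID bad) /= setTI addnC; apply: leq_add.
  apply: leq_trans (_ : \sum_(w in setT :\: bad) b.-1 <= _).
    by apply: leq_sum => w; rewrite !inE andbT -ltnNge => wb; rewrite -ltnS prednK.
  by rewrite sum_nat_const mulnC leq_mul2l subset_leq_card ?orbT // subsetDl.
apply: leq_trans (_ : \sum_(w in bad) #|U| <= _); first by apply: leq_sum => w _;
  apply: deg_le_card.
by rewrite sum_nat_const leq_mul2r card_bad orbT.
Qed.

Section Stability.
Local Open Scope ring_scope.
Variable R : realType.

Lemma powR_pred_ge (p eta : R) : 0 <= p -> 0 < eta ->
  exists n0 : nat, forall n, (n0 <= n)%N -> (1 - eta) * n%:R `^ p <= n.-1%:R `^ p.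
Proof.
(* The threshold ensures [p / (n - 1) < eta], so that [exp (- p / (n - 1)) >= 1 - eta]. *)
move=> p0 eta0; exists (Num.truncn (p / eta)).+3 => n.
move tE : (Num.truncn (p / eta)) => t n_ge.
have n2 : (2 : R) <= n%:R by rewrite ler_nat; move: n_ge; clear; lia.
have predn : n.-1%:R = n%:R - 1 :> R by rewrite -subn1 natrB //; move: n_ge; clear; lia.
have m0 : (0 : R) < n.-1%:R by rewrite predn; lra.
have ratio : p / eta < n.-1%:R :> R.
  apply: lt_le_trans (truncnS_gt _) _; rewrite tE ler_nat; move: n_ge; clear; lia.
have {}ratio : p / n.-1%:R < eta by move: ratio; rewrite !ltr_pdivrMr // mulrC.
have lnn : ln n%:R <= ln n.-1%:R + n.-1%:R^-1 :> R.
  have -> : n%:R = n.-1%:R * (1 + n.-1%:R^-1) :> R.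
    by rewrite mulrDr mulfV ?gt_eqF // predn; ring.
  have inv0 : 0 < n.-1%:R^-1 :> R by rewrite invr_gt0.
  by rewrite lnM ?posrE ?lerD2l ?le_ln1Dx //; lra.
have n0R : (0 : R) < n%:R by lra.
rewrite /powR !gt_eqF //.
apply: le_trans (_ : expR (- (p / n.-1%:R)) * expR (p * ln n%:R) <= _).
  rewrite ler_wpM2r ?expR_ge0 //; apply: le_trans (expR_ge1Dx _); lra.
rewrite -expRD ler_expR; have := ler_wpM2l p0 lnn; rewrite mulrDr; lra.
Qed.

Lemma tail_small (c s eta : R) : 0 <= c -> 0 < s -> 0 < eta ->
  exists2 M : nat, (0 < M)%N & c * M%:R `^ (- s) <= eta.
Proof.
move=> c0 s0 eta0; exists (Num.truncn ((c / eta) `^ s^-1)).+1 => //.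
set M := _.+1; have M0 : (0 : R) < M%:R by rewrite ltr0n.
have Ms : c / eta <= M%:R `^ s.
  have -> : c / eta = ((c / eta) `^ s^-1) `^ s.
    by rewrite -powRrM mulVf ?gt_eqF // powRr1 // divr_ge0 // ltW.
  by apply: ler_pow; rewrite ?powR_ge0 ?(ltW s0) //; apply/ltW/truncnS_gt.
rewrite powRN ler_pdivrMr ?powR_gt0 //; move: Ms; rewrite ler_pdivrMr //; lra.
Qed.

(** Scaled by [1 / n], the [M] degrees left by the tail estimate lie in [[0, 1]], sum to at most
    [s + eta], and have [p]-th powers summing to nearly [s] or more. Since values below [1 - eps]
    shrink by a factor [g < 1] when raised to the power [p], at least [s] values must reach
    [1 - eps]. *)
Lemma exists_hubs (ks : seq nat) (k : nat) (p eps : R) : (1 < k)%N -> all (leq k) ks ->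
  (0 < sumn ks)%N -> k%:R / (k%:R - 1) < p -> 0 < eps < 1 ->
  exists n0 : nat, forall (V : finType) (e : rel V), symmetric e -> irreflexive e ->
    ~ has_cycles e setT ks -> (n0 <= #|V|)%N ->
    (sumn ks).-1%:R * #|V|.-1%:R `^ p <= \sum_v (deg e setT v)%:R `^ p ->
    exists2 A : {set V}, #|A| = (sumn ks).-1 &
      forall a, a \in A -> (1 - eps) * #|V|%:R <= (deg e setT a)%:R.
Proof.
move=> k1 k_ks b0 hp /andP[eps0 eps1]; set s := (sumn ks).-1.
have p1 := exponent_gt1 k1 hp.
have p0 : 0 <= p by lra.
pose g : R := (1 - eps) `^ (p - 1).
have g0 : 0 <= g by apply: powR_ge0.
have g1 : g < 1.
  have one : (1 : R) `^ (p - 1) = 1 by rewrite powR1.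
  rewrite -[ltRHS]one; apply: gt0_ltr_powR; rewrite ?nnegrE; lra.
(* With at most [s - 1] hubs the powers would sum to at most [(s - 1) + g (1 + eta)]; this [eta]
   puts that below the lower bound [s - (s + 1) eta]. *)
pose eta : R := (1 - g) / (s%:R + 3).
have s_ge0 : (0 : R) <= s%:R by [].
have eta0 : 0 < eta by rewrite divr_gt0; lra.
have eta_eq : eta * (s%:R + 3) = 1 - g by rewrite mulfVK // gt_eqF //; lra.
have sig0 := tail_exponent_gt0 k1 hp.
have [M M0 tailM] := tail_small (tail_const_ge0 ks sig0) sig0 eta0.
have [n1 pred_n1] := powR_pred_ge p0 eta0.
pose C := (2 ^ M * sumn ks * M)%N.
exists (maxn (maxn M n1) (Num.truncn (C%:R / eta)).+1) => V e e_sym e_irr nocyc.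
set n := #|V|; rewrite !geq_max => /andP[/andP[nM nn1] nC] big.
have n0R : (0 : R) < n%:R by rewrite ltr0n (leq_trans _ nM).
have {}nC : C%:R <= eta * n%:R :> R.
  have : C%:R / eta <= n%:R by apply: le_trans (ltW (truncnS_gt _)) _; rewrite ler_nat.
  by rewrite ler_pdivrMr // mulrC.
have [|U [_ cU tailU]] := @degree_power_tail R V e k ks p e_sym e_irr k1 k_ks hp setT setT M nocyc (subxx _).
  by rewrite M0 cardsT.
have sumU := sum_deg_small_set U e_sym e_irr nocyc b0.
pose x v : R := (deg e setT v)%:R / n%:R.
have x0 v : 0 <= x v by rewrite divr_ge0.
have x1 v : x v <= 1 by rewrite ler_pdivrMr // mul1r ler_nat (leq_trans (deg_le_card _ _ _)) ?cardsT.
have xp v : (deg e setT v)%:R `^ p = n%:R `^ p * x v `^ p.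
  by rewrite -powRM ?(ltW n0R) // mulrC mulfVK // gt_eqF.
have np0 : 0 < n%:R `^ p by apply: powR_gt0.
have sum_x : \sum_(v in U) x v <= s%:R + eta.
  rewrite -mulr_suml ler_pdivrMr // mulrDl -natr_sum.
  apply: le_trans (_ : (s * n + C)%:R <= _); first by rewrite ler_nat /C -cU.
  by rewrite natrD natrM lerD2l.
have sum_xp : s%:R * (1 - eta) <= \sum_(v in U) x v `^ p + eta.
  rewrite -(ler_pM2l np0) [leRHS]mulrDr.
  have -> : n%:R `^ p * \sum_(v in U) x v `^ p = \sum_(v in U) (deg e setT v)%:R `^ p.
    by rewrite mulr_sumr; apply: eq_bigr => v _; rewrite xp.
  have sum_all : \sum_v (deg e setT v)%:R `^ p = \sum_(v in setT) (deg e setT v)%:R `^ p :> R.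
    by apply: eq_bigl => v; rewrite inE.
  have := ler_wpM2l s_ge0 (pred_n1 n nn1).
  have := ler_wpM2l (ltW np0) tailM.
  rewrite sum_all -/n in big; rewrite cardsT -/n in tailU.
  move: big tailU; lra.
pose A := [set v in U | 1 - eps <= x v].
have AU : A \subset U by apply/subsetP => v; rewrite inE => /andP[].
have [sA|As] := leqP s #|A|.
  have [A' A'A cA'] := subset_of_card sA; exists A' => // a /(subsetP A'A).
  by rewrite inE => /andP[_]; rewrite /x ler_pdivlMr.
have split (f : V -> R) : \sum_(v in U) f v = \sum_(v in A) f v + \sum_(v in U :\: A) f v.
  by rewrite (big_setID A) /= (setIidPr AU).
have sumA : \sum_(v in A) x v <= s%:R - 1.
  apply: le_trans (_ : \sum_(v in A) 1 <= _); first by apply: ler_sum.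
  by rewrite sumr_const lerBrDr natr1 ler_nat.
have leA : \sum_(v in A) x v `^ p <= \sum_(v in A) x v.
  apply: ler_sum => v _; rewrite -[leRHS]powRr1 //.
  have [->|xv] := eqVneq (x v) 0; first by rewrite !powR0 ?oner_eq0 // gt_eqF //; lra.
  by apply: ger_powR; rewrite ?lt_neqAle ?x0 ?x1 1?eq_sym ?xv // ltW.
have leUA : \sum_(v in U :\: A) x v `^ p <= g * \sum_(v in U :\: A) x v.
  rewrite mulr_sumr; apply: ler_sum => v; rewrite !inE => /andP[+ vU]; rewrite vU /= -ltNge => xv.
  rewrite -mulr_powRB1 //; last by lra.
  rewrite mulrC ler_wpM2r // ler_pow //; lra.
exfalso; rewrite split in sum_xp; rewrite split in sum_x.
move: sum_x sum_xp leA leUA sumA.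
move: (\sum_(v in A) x v) (\sum_(v in U :\: A) x v) (\sum_(v in A) x v `^ p) (\sum_(v in U :\: A) x v `^ p) => a b a' b' h1 h2 h3 h4 h5.
nra.
Qed.

End Stability.

(** * Comparison with the extremal degree power *)

Lemma deg_le_pred (V : finType) (e : rel V) (S : {set V}) x :
  irreflexive e -> deg e S x <= #|V|.-1.
Proof.
move=> e_irr; rewrite -(cardsC1 x); apply/subset_leq_card/subsetP => y.
by rewrite !inE => /andP[_]; apply: contraTneq => ->; rewrite e_irr.
Qed.

Section Hubs.
Variables (V : finType) (e : rel V) (A : {set V}).
Hypotheses (e_sym : symmetric e) (e_irr : irreflexive e).

Definition common := [set x | [forall a in A, e a x]].
Definition leftover := ~: A :\: common.

Lemma common_complete : {in A & common, forall a x, e a x}.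
Proof. by move=> a x aA; rewrite inE => /forall_inP; apply. Qed.

Lemma common_notin x : x \in common -> x \notin A.
Proof.
rewrite inE => /forall_inP h; apply/negP => /[dup] xA /h.
by rewrite e_irr.
Qed.

Lemma deg_partition w : deg e setT w = deg e A w + deg e common w + deg e leftover w.
Proof.
rewrite -!degU.
- congr (deg e _ w); apply/setP => x; rewrite in_setT !in_setU in_setD in_setC.
  by case: (x \in A); case: (x \in common).
- apply/pred0P => x /=; rewrite in_setU in_setD in_setC.
  by case: (x \in A); case: (x \in common).
- apply/pred0P => x /=; apply/andP => -[xA xX].
  by have := common_notin xX; rewrite xA.
Qed.

Lemma card_common_leftover : #|A| + #|common| + #|leftover| = #|V|.
Proof.
rewrite -addnA -(cardsC A) -(cardsID common (~: A)); congr (_ + (_ + _)).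
by congr #|pred_of_set _|; apply/esym/setIidPr/subsetP => x xX; rewrite inE common_notin.
Qed.

(** Every vertex outside [common] misses at least one hub; a hub misses itself. *)
Lemma sum_deg_hubs : \sum_(a in A) deg e setT a + #|~: common| <= #|A| * #|V|.
Proof.
have -> : #|A| * #|V| = \sum_(a in A) deg e setT a + \sum_(a in A) \sum_x ~~ e a x.
  rewrite -big_split -sum_nat_const; apply: eq_bigr => a _ /=.
  rewrite degE -sum1_card [X in _ = X + _](eq_bigl xpredT); last by move=> x; rewrite inE.
  by rewrite -big_split; apply: eq_bigr => x _; case: (e a x).
rewrite leq_add2l exchange_big -sum1_card big_mkcond; apply: leq_sum => x _ /=.
rewrite !inE; case: ifP => // /forall_inPn[a aA nax].
by rewrite (bigD1 a) //= nax.
Qed.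

(** Discounting the self-misses of the hubs turns [#|V|] into [#|V| - 1], the largest possible
    degree. *)
Lemma sum_deg_hubs_leftover : \sum_(a in A) deg e setT a + #|leftover| <= #|A| * #|V|.-1.
Proof.
have [A0|[a aA]] := set_0Vmem A.
  have -> : leftover = set0.
    rewrite /leftover A0; apply/setP => x; rewrite !inE A0; apply/negP => /andP[/negP[]].
    by apply/forall_inP => b; rewrite inE.
  by rewrite A0 big_set0 cards0.
have V0 : 0 < #|V| by apply/card_gt0P; exists a.
rewrite -(leq_add2r #|A|) -mulnSr prednK //; apply: leq_trans sum_deg_hubs.
rewrite -addnA leq_add2l; have := card_common_leftover; have := cardsC common.
by clear; lia.
Qed.

Lemma deg_hubs x : x \in common -> deg e A x = #|A|.
Proof.
move=> xX; apply: eq_card => a; rewrite !inE; case aA: (a \in A) => //=.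
by rewrite e_sym common_complete.
Qed.

End Hubs.

Section Comparison.
Local Open Scope ring_scope.
Variable R : realType.

(** For positive [d] one has [s + 1 + d <= (s + 2) d]; the summand 1 covers [d = 0]. *)
Lemma powR_addn_le (s d : nat) (p : R) : 0 <= p ->
  (s + 1 + d)%:R `^ p <= (s + 2)%:R `^ p * (1 + d%:R `^ p).
Proof.
move=> p0; rewrite mulrDr mulr1; case: d => [|d].
  rewrite addn0; apply: le_trans (_ : (s + 2)%:R `^ p <= _); last first.
    by rewrite lerDl mulr_ge0 ?powR_ge0.
  by apply: ler_pow; rewrite ?ler_nat //; lia.
apply: le_trans (_ : (s + 2)%:R `^ p * d.+1%:R `^ p <= _); last by rewrite lerDr powR_ge0.
by rewrite -powRM // -natrM; apply: ler_pow; rewrite ?ler_nat //; nia.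
Qed.

Definition excess_const (s k : nat) (ks : seq nat) (p : R) : R :=
  (s + 2)%:R `^ p * (3 + tail_const p k ks).

Variables (V : finType) (e : rel V) (A : {set V}) (k : nat) (ks : seq nat) (p : R).
Hypotheses (e_sym : symmetric e) (e_irr : irreflexive e) (nocyc : ~ has_cycles e setT ks).
Hypotheses (k1 : (1 < k)%N) (k_ks : all (leq k) ks) (hp : k%:R / (k%:R - 1) < p).
Let X := common e A.
Let Y := leftover e A.
Hypothesis sparse : forall w, w \notin A -> (deg e X w <= 1)%N.
Let s := #|A|.

Let p1 : 1 < p. Proof. exact: exponent_gt1 hp. Qed.
Let p0 : 0 <= p. Proof. by have := p1; lra. Qed.

Lemma powR_pred_mul (x y : nat) : (x <= y)%N -> x%:R `^ p <= x%:R * y%:R `^ (p - 1).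
Proof.
move=> xy; rewrite -mulr_powRB1 //; last by have := p1; lra.
by rewrite ler_wpM2l // ler_pow ?ler_nat //; have := p1; lra.
Qed.

Lemma sum_deg_common_leftover : (\sum_(x in X) deg e Y x <= #|Y|)%N.
Proof.
rewrite (sum_degC _ _ e_sym) -sum1_card; apply: leq_sum => y.
by rewrite !inE => /andP[_ yA]; apply: sparse.
Qed.

(** A vertex of [X] with [z > 0] neighbours in [Y] has degree at most [(s + 2) z], and
    [z ^ p <= z #|Y| ^ (p - 1)]; by sparsity the sum of all [z] is at most [#|Y|]. *)
Lemma sum_common : \sum_(x in X) (deg e setT x)%:R `^ p <=
  \sum_(x in X) (s + deg e X x)%:R `^ p + (s + 2)%:R `^ p * #|Y|%:R `^ p.
Proof.
apply: le_trans (_ : \sum_(x in X) ((s + deg e X x)%:R `^ p +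
    (s + 2)%:R `^ p * ((deg e Y x)%:R * #|Y|%:R `^ (p - 1))) <= _).
  apply: ler_sum => x xX; rewrite (deg_partition A e_irr) deg_hubs // -/s -/X -/Y.
  apply: le_trans (_ : (s + deg e X x)%:R `^ p + (s + 2)%:R `^ p * (deg e Y x)%:R `^ p <= _);
    last first.
    by rewrite lerD2l ler_wpM2l ?powR_ge0 // powR_pred_mul // deg_le_card.
  have dX := sparse (common_notin e_irr xX); move: (deg e Y x) dX => [|z] dX.
    by rewrite addn0 lerDl mulr_ge0 ?powR_ge0.
  rewrite -powRM // -natrM; apply: le_trans (_ : ((s + 2) * z.+1)%:R `^ p <= _).
    by apply: ler_pow; rewrite ?ler_nat //; move: dX; clear; nia.
  by rewrite lerDr powR_ge0.
rewrite big_split lerD2l -mulr_sumr ler_wpM2l ?powR_ge0 // -mulr_suml -natr_sum.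
rewrite -[leRHS]mulr_powRB1 //; last by have := p1; lra.
by rewrite ler_wpM2r ?powR_ge0 // ler_nat sum_deg_common_leftover.
Qed.

(** Outside [Y] such a vertex has at most [s + 1] neighbours; [Y] itself contains no copy of the
    cycle family either, so [degree_power_bound] applies inside it. *)
Lemma sum_leftover : \sum_(y in Y) (deg e setT y)%:R `^ p <=
  (s + 2)%:R `^ p * (2 + tail_const p k ks) * #|Y|%:R `^ p.
Proof.
apply: le_trans (_ : \sum_(y in Y) (s + 2)%:R `^ p * (1 + (deg e Y y)%:R `^ p) <= _).
  apply: ler_sum => y; rewrite !inE => /andP[_ yA]; apply: le_trans (powR_addn_le _ _ p0).
  apply: ler_pow => //; rewrite ler_nat (deg_partition A e_irr) leq_add2r.
  by apply: leq_add; [apply: deg_le_card|apply: sparse].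
rewrite -mulr_sumr -mulrA ler_wpM2l ?powR_ge0 // big_split /= sumr_const.
have nocycY : ~ has_cycles e Y ks by move=> /(has_cycles_subset (subsetT _)).
have := degree_power_bound e_sym e_irr k1 k_ks hp nocycY (subxx Y).
have : #|Y|%:R <= #|Y|%:R `^ p.
  have [->|Y0] := posnP #|Y|; first exact: powR_ge0.
  by rewrite -[leLHS]powRr1 // ler_powR ?ler1n // ltW.
by move: p1; lra.
Qed.

Lemma degree_power_comparison :
  \sum_v (deg e setT v)%:R `^ p <= \sum_(a in A) (deg e setT a)%:R `^ p +
    \sum_(x in X) (s + deg e X x)%:R `^ p + excess_const s k ks p * #|Y|%:R `^ p.
Proof.
have -> : \sum_v (deg e setT v)%:R `^ p = \sum_(a in A) (deg e setT a)%:R `^ p +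
    (\sum_(x in X) (deg e setT x)%:R `^ p + \sum_(y in Y) (deg e setT y)%:R `^ p) :> R.
  rewrite (bigID (mem A)) /=; congr (_ + _).
  rewrite (bigID (mem X)) /=; congr (_ + _); apply: eq_bigl => x.
    by apply/andP/idP => [[]//|xX]; split=> //; apply: common_notin xX.
  by rewrite in_setD in_setC andbC.
by have := sum_common; have := sum_leftover; rewrite /excess_const; lra.
Qed.

(** By [d ^ p <= d (n - 1) ^ (p - 1)], every missing adjacency at a hub costs
    [(n - 1) ^ (p - 1)]. *)
Lemma sum_hubs : \sum_(a in A) (deg e setT a)%:R `^ p <=
  s%:R * #|V|.-1%:R `^ p - #|Y|%:R * #|V|.-1%:R `^ (p - 1).
Proof.
apply: le_trans (_ : \sum_(a in A) (deg e setT a)%:R * #|V|.-1%:R `^ (p - 1) <= _).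
  by apply: ler_sum => a _; apply/powR_pred_mul/deg_le_pred.
have := sum_deg_hubs_leftover A e_irr; rewrite -/Y -/s => le.
rewrite -mulr_suml -[#|V|.-1%:R `^ p in leRHS]mulr_powRB1 //; last by have := p1; lra.
rewrite mulrA -mulrBl ler_wpM2r ?powR_ge0 // -natr_sum lerBrDr -natrM -natrD ler_nat.
exact: le.
Qed.

End Comparison.

(** * Structure of the extremal graphs *)

Section Structure.
Local Open Scope ring_scope.
Variable R : realType.

Lemma degree_01_power_sum (V : finType) (S : {set V}) (d : V -> nat) (s : nat) (p : R) :
  {in S, forall x, (d x <= 1)%N} ->
  \sum_(x in S) (s + d x)%:R `^ p =
  #|S|%:R * s%:R `^ p + (\sum_(x in S) d x)%:R * (s.+1%:R `^ p - s%:R `^ p).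
Proof.
move=> d1; rewrite natr_sum mulr_suml mulr_natl -sumr_const -big_split /=.
apply: eq_bigr => x /d1; case: (d x) => [|[|//]] _; first by rewrite addn0 mul0r addr0.
by rewrite addn1 mul1r addrC subrK.
Qed.

(** [J] is the degree sum outside the hubs in the target graph and the maximum allowed inside the
    common neighbourhood. Leaving [y] vertices outside gains at most [K y ^ p] but loses
    [y (n - 1) ^ (p - 1)], so the lower bound forces [y = 0] and equality throughout. *)
Lemma extremal_structure (k : nat) (ks : seq nat) (p : R) : (1 < k)%N -> all (leq k) ks ->
  k%:R / (k%:R - 1) < p -> let s := (k + sumn ks).-1 in
  exists n0 : nat, forall (V : finType) (e : rel V) (J : nat), symmetric e -> irreflexive e ->
    ~ has_cycles e setT (k :: ks) -> (n0 <= #|V|)%N ->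
    (forall A : {set V}, #|A| = s -> (s.+1 < #|common e A|)%N ->
      {in common e A, forall x, (deg e (common e A) x <= 1)%N} ->
      (\sum_(x in common e A) deg e (common e A) x <= J)%N) ->
    s%:R * #|V|.-1%:R `^ p + (#|V| - s)%:R * s%:R `^ p + J%:R * (s.+1%:R `^ p - s%:R `^ p)
      <= \sum_v (deg e setT v)%:R `^ p ->
    exists A : {set V}, [/\ #|A| = s, {in A, forall a, deg e setT a = #|V|.-1},
      {in ~: A, forall x, (deg e (~: A) x <= 1)%N} &
      (\sum_(x in ~: A) deg e (~: A) x = J)%N].
Proof.
move=> k1 k_ks hp s; have p1 := exponent_gt1 k1 hp.
have k_kks : all (leq k) (k :: ks) by rewrite /= leqnn.
have s0 : (0 < s)%N by rewrite /s; move: k1; clear; lia.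
have s1R : (1 : R) <= s%:R by rewrite ler1n.
pose K : R := excess_const s k (k :: ks) p.
have tail0 := tail_const_ge0 (k :: ks) (tail_exponent_gt0 k1 hp).
have K1 : 1 <= K.
  have : 1 <= (s + 2)%:R `^ p :> R.
    by rewrite -[leLHS](powRr0 (s + 2)%:R) ler_powR ?ler1n ?addn2 //; lra.
  by rewrite /K /excess_const; move: tail0; nra.
(* For [y <= delta (n - 1)] this makes [K y ^ p] at most half of [y (n - 1) ^ (p - 1)]. *)
pose delta : R := (2 * K)^-1 `^ (p - 1)^-1.
have K0 : 0 < 2 * K by lra.
have delta0 : 0 < delta by apply: powR_gt0; rewrite invr_gt0.
have delta_pow : K * delta `^ (p - 1) = 2^-1.
  rewrite /delta -powRrM mulVf ?powRr1 ?invr_ge0 ?ltW //; last by rewrite gt_eqF; lra.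
  by rewrite invfM mulrCA mulfV ?mulr1 // gt_eqF; lra.
have delta1 : delta < 1.
  have one : (1 : R) `^ (p - 1) = 1 by rewrite powR1.
  rewrite ltNge; apply/negP => d1; have := ler_pow (p := p - 1) ltac:(lra) ler01 d1.
  rewrite one => dp; have := ler_wpM2l (x := K) ltac:(lra) dp; rewrite delta_pow; lra.
(* The [s] hubs together miss at most [s eps n = delta n / 2] vertices, hence at most
   [delta (n - 1)]. *)
pose eps := delta / (2 * s%:R).
have eps_s : s%:R * eps = delta / 2 by rewrite /eps; field; lra.
have eps01 : 0 < eps < 1 by rewrite divr_gt0 //=; [rewrite ltr_pdivrMr; lra|lra].
have b0 : (0 < sumn (k :: ks))%N by rewrite /=; move: k1; clear; lia.
have [n1 hubs] := exists_hubs k1 k_kks b0 hp eps01.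
(* More than half of the vertices are common neighbours; [2 s + 5] makes their number exceed
   [s + 1]. *)
exists (maxn n1 (2 * s + 5)) => V e J e_sym e_irr nocyc;
  rewrite geq_max => /andP[nn1 ns] Jmax big.
have D0 : 0 < s.+1%:R `^ p - s%:R `^ p :> R.
  by rewrite subr_gt0; apply: gt0_ltr_powR; rewrite ?nnegrE ?ltr_nat //; lra.
have n0R : (0 : R) < #|V|%:R by rewrite ltr0n; move: ns; clear; lia.
have [|A cA Adeg] := hubs V e e_sym e_irr nocyc nn1.
  apply: le_trans big; rewrite -addrA lerDl addr_ge0 ?mulr_ge0 ?powR_ge0 //; exact: ltW.
rewrite /= -/s in cA.
have misses : #|~: common e A|%:R <= s%:R * eps * #|V|%:R :> R.
  have := sum_deg_hubs e A; rewrite -(ler_nat R) natrD natrM cA natr_sum.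
  have : s%:R * ((1 - eps) * #|V|%:R) <= \sum_(a in A) (deg e setT a)%:R :> R.
    by rewrite -cA mulr_natl -sumr_const; apply: ler_sum.
  lra.
have large : (s.+1 < #|common e A|)%N.
  have := cardsC (common e A); rewrite -(ltr_nat R) => cc.
  have : (2 * s + 5)%:R <= #|V|%:R :> R by rewrite ler_nat.
  rewrite natrD natrM; move: misses; rewrite eps_s -cc natrD -(natr1 s); nra.
have sparse w : w \notin A -> (deg e (common e A) w <= 1)%N.
  move=> wA; rewrite leqNgt; apply/negP => /card_gt1P[x1 [x2 []]].
  rewrite inE => /andP[x1X ew1]; rewrite inE => /andP[x2X ew2] x12; apply: nocyc.
  apply: (cherry_has_cycles e_sym e_irr (@common_complete _ _ A) k1 _ _ wA x1X x2X x12 ew1 ew2).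
    by rewrite cA /s; move: k1; clear; lia.
  by move: large; rewrite /s; move: k1; clear; lia.
have sparse' : {in common e A, forall x, (deg e (common e A) x <= 1)%N}.
  by move=> x xX; apply/sparse/common_notin.
have JX := Jmax A cA large sparse'.
have cmp := degree_power_comparison e_sym e_irr nocyc k1 k_kks hp sparse.
have hubsum := sum_hubs A e_irr k1 hp.
rewrite cA degree_01_power_sum // -/K in cmp.
rewrite cA in hubsum.
have parts := card_common_leftover A e_irr; rewrite cA in parts.
have JD : (\sum_(x in common e A) deg e (common e A) x)%:R * (s.+1%:R `^ p - s%:R `^ p) <=
    J%:R * (s.+1%:R `^ p - s%:R `^ p) :> R by rewrite ler_wpM2r ?ler_nat // ltW.
have Xn : #|common e A|%:R * s%:R `^ p <= (#|V| - s)%:R * s%:R `^ p :> R.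
  by rewrite ler_wpM2r ?powR_ge0 // ler_nat -parts; clear; lia.
have Y0 : #|leftover e A| = 0.
  apply/eqP; rewrite -leqn0 leqNgt; apply/negP => Y0.
  have Y0R : (0 : R) < #|leftover e A|%:R by rewrite ltr0n.
  have Yn : #|leftover e A|%:R <= delta * #|V|.-1%:R :> R.
    apply: le_trans (_ : #|~: common e A|%:R <= _).
      by rewrite ler_nat; apply/subset_leq_card; rewrite /leftover setDE subsetIr.
    apply: le_trans misses _; rewrite eps_s.
    have : #|V|%:R <= 2 * #|V|.-1%:R :> R by rewrite -natrM ler_nat; move: ns; clear; lia.
    by move: delta0; nra.
  have n1R : (0 : R) < #|V|.-1%:R by rewrite ltr0n; move: ns; clear; lia.
  have : K * #|leftover e A|%:R `^ p <= 2^-1 * (#|leftover e A|%:R * #|V|.-1%:R `^ (p - 1)).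
    rewrite -mulr_powRB1 //; last by lra.
    rewrite mulrCA [leRHS]mulrCA ler_wpM2l // -delta_pow. rewrite -[leRHS]mulrA ler_wpM2l //;
      first by lra.
    by rewrite -powRM //; [apply: ler_pow => //; lra|exact: ltW].
  have : 0 < #|leftover e A|%:R * #|V|.-1%:R `^ (p - 1) by rewrite mulr_gt0 ?powR_gt0.
  move: big cmp hubsum JD Xn; lra.
have XA : common e A = ~: A.
  apply/eqP; rewrite eqEsubset; apply/andP; split; last first.
    by rewrite -setD_eq0; move/eqP: Y0; rewrite cards_eq0.
  by apply/subsetP => x xX; rewrite inE (common_notin e_irr xX).
rewrite Y0 powR0 ?mulr0 ?addr0 in cmp; last by rewrite gt_eqF //; lra.
rewrite Y0 mul0r subr0 in hubsum.
(* Now the upper and lower bounds have the same shape, which fixes the degree sum outside [A];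
   below, nonnegative [gap] terms with sum at most 0 must vanish. *)
exists A; rewrite -XA; split=> //; last first.
  apply/eqP; rewrite eqn_leq JX -(ler_nat R) -(ler_pM2r D0) /=.
  by move: big cmp hubsum Xn; lra.
pose gap a : R := #|V|.-1%:R `^ p - (deg e setT a)%:R `^ p.
have gap0 a : 0 <= gap a.
  by rewrite subr_ge0; apply: ler_pow; rewrite ?ler_nat ?deg_le_pred //; lra.
have : \sum_(a in A) gap a = 0.
  apply/eqP; rewrite eq_le sumr_ge0 // andbT sumrB sumr_const cA -[X in X - _]mulr_natl.
  by move: big cmp JD Xn; lra.
move=> /psumr_eq0P gapA a aA; have /eqP := gapA (fun a _ => gap0 a) a aA.
rewrite subr_eq0 => /eqP gap_a; apply/eqP; rewrite eqn_leq deg_le_pred //= leqNgt;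
  apply/negP => lt_a.
have : (deg e setT a)%:R `^ p < #|V|.-1%:R `^ p :> R.
  by apply: gt0_ltr_powR; rewrite ?nnegrE ?ltr_nat //; lra.
by rewrite gap_a ltxx.
Qed.

End Structure.

(** * The forbidden and the extremal graphs *)

Lemma cycle_nth (T : eqType) (e : rel T) (x0 : T) (c : seq T) j : cycle e c -> j < size c ->
  e (nth x0 c j) (nth x0 c (j.+1 %% size c)).
Proof.
case: c => // x c /(pathP x0) h jc; have := h j; rewrite size_rcons => /(_ jc).
have -> : nth x0 (x :: rcons c x) j = nth x0 (x :: c) j.
  by rewrite -rcons_cons nth_rcons jc.
rewrite nth_rcons; have [jlt|jge] := ltnP j (size c).
  by rewrite modn_small.
have -> : j = size c by apply/eqP; rewrite eqn_leq -ltnS jc.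
by rewrite eqxx modnn.
Qed.

(** Vertex [a] of the [i]-th cycle is sent to entry [a] of the [i]-th sequence. Read as a position
    in the concatenation, this is injective by uniqueness. *)
Lemma contains_even_cycles (V : finType) (G : sgraph V) (t : nat) (k : nat -> nat) :
  0 < t -> 0 < k 1 -> has_cycles (adj G) setT [seq k i | i <- iota 1 t] ->
  contains (even_cycles t k) G.
Proof.
move=> t0 k0 [cs [scs ccs ucs _]].
have szcs : size cs = t by rewrite -(size_map size) scs !size_map size_iota.
have szi i : i < t -> size (nth [::] cs i) = 2 * k i.+1.
  move=> it; rewrite -(nth_map [::] 0 size) ?szcs // scs (nth_map 0) ?size_map ?size_iota //.
  by rewrite (nth_map 0) ?size_iota // nth_iota // add1n mul2n.
(* A default vertex for [nth], available because the first cycle is nonempty. *)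
have x0 : V.
  case: cs szcs szi {scs ccs ucs} => [t00|c cs _ szi]; first by rewrite -t00 in t0.
  by have := szi 0 t0; case: c {szi} => [k00|//]; exfalso; move: k0 k00 => /=; clear; lia.
have sh i : nth 0 (shape cs) i = size (nth [::] cs i).
  have [ics|ics] := ltnP i (size cs); first by rewrite (nth_map [::]).
  by rewrite !nth_default ?size_map.
pose pos (u : {i : 'I_t & 'I_(2 * k i.+1)}) := flatten_index (shape cs) (tag u) (tagged u).
have lt_tagged (u : {i : 'I_t & 'I_(2 * k i.+1)}) : tagged u < nth 0 (shape cs) (tag u).
  by rewrite sh szi.
pose f : {ffun {i : 'I_t & 'I_(2 * k i.+1)} -> V} := [ffun u => nth x0 (flatten cs) (pos u)].
have fE u : f u = nth x0 (nth [::] cs (tag u)) (tagged u).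
  by rewrite ffunE nth_flatten /pos flatten_indexKl ?flatten_indexKr.
apply/existsP; exists f; apply/andP; split.
  apply/injectiveP => u v; rewrite !ffunE => /eqP; rewrite nth_uniq //; last 2 first.
  - by rewrite size_flatten flatten_indexP.
  - by rewrite size_flatten flatten_indexP.
  move=> /eqP uv; have tuv : tag u = tag v :> nat.
    by rewrite -(flatten_indexKl (lt_tagged u)) -/(pos u) uv flatten_indexKl.
  have auv : tagged u = tagged v :> nat.
    by rewrite -(flatten_indexKr (lt_tagged u)) -/(pos u) uv flatten_indexKr.
  move: u v tuv auv {uv} => [i a] [i' a'] /= /val_inj ii'; move: a';
    rewrite -ii' => a' /val_inj -> //.
apply/forallP => u; apply/forallP => v; apply/implyP; rewrite /even_cycles adj_graph_of_rel.
have step (i : 'I_t) (a b : 'I_(2 * k i.+1)) : b == a.+1 %% (2 * k i.+1) :> nat ->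
    adj G (nth x0 (nth [::] cs i) a) (nth x0 (nth [::] cs i) b).
  have /= szcsi := szi i (ltn_ord i).
  have cyc : cycle (adj G) (nth [::] cs i) by apply: (allP ccs); rewrite mem_nth // szcs.
  by move=> /eqP ->; have := cycle_nth x0 cyc (j := a); rewrite szcsi; apply.
case/andP => _; rewrite !fE.
move: u v => [i a] [i' b] /= /orP[] /andP[/eqP /= ii']; subst i';
  rewrite tagged_asE adj_graph_of_rel.
  by case/andP=> _ /orP[/step//|/step]; rewrite adj_sym.
by case/andP=> _ /orP[/step|/step//]; rewrite adj_sym.
Qed.

Lemma degree_deg (V : finType) (G : sgraph V) x : degree G x = deg (adj G) setT x.
Proof. by apply: eq_card => y; rewrite !inE. Qed.

(** The maximum ranges over graphs on ['I_n] only, so [H] is transported along [enum_val]. *)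
Lemma ex_degree_power_ge (R : realType) (p : R) (n : nat) (U V : finType) (F : sgraph U) (H : sgraph V) :
  #|V| = n -> graph_free F H -> (degree_power p H <= ex_degree_power p n F)%R.
Proof.
move=> cV; subst n => free.
pose H' : sgraph 'I_#|V| := graph_of_rel (fun i j => adj H (enum_val i) (enum_val j)).
have H'E i j : adj H' i j = adj H (enum_val i) (enum_val j).
  rewrite adj_graph_of_rel [adj H (enum_val j) _]adj_sym orbb.
  by have [->|//] := eqVneq i j; rewrite adj_irr.
have degE' i : degree H' i = degree H (enum_val i).
  rewrite /degree -(card_imset _ (@enum_val_inj _ V)); apply: eq_card => y; rewrite inE.
  apply/imsetP/idP => [[j]|Hy]; first by rewrite inE H'E => ? ->.
  by exists (enum_rank y); rewrite ?inE ?H'E enum_rankK.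
have -> : degree_power p H = degree_power p H'.
  rewrite /degree_power (reindex (@enum_val _ V)) /=; last first.
    by exists enum_rank => x _; rewrite ?enum_valK ?enum_rankK.
  by apply: eq_bigr => i _; rewrite degE'.
apply: (le_bigmax_cond 0%R (fun G : sgraph _ => degree_power p G)).
apply: contra free => /existsP[f /andP[/injectiveP f_inj /forallP f_hom]].
apply/existsP; exists [ffun u => enum_val (f u)]; apply/andP; split.
  by apply/injectiveP => u v; rewrite !ffunE => /enum_val_inj/f_inj.
by apply/forallP => u; apply/forallP => v; rewrite !ffunE -H'E; have /forallP := f_hom u.
Qed.

(** * Freeness of the two target graphs *)

Lemma modn_succ_neq n x : 1 < n -> x < n -> x.+1 %% n <> x.
Proof.
move=> n1; rewrite leq_eqVlt => /predU1P[xn|xn]; first by rewrite xn modnn; lia.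
by rewrite modn_small //; lia.
Qed.

Lemma modn_succ2_neq n x : 2 < n -> x < n -> (x.+1 %% n).+1 %% n <> x.
Proof.
move=> n2; rewrite leq_eqVlt => /predU1P[xn|xn].
  by rewrite xn modnn modn_small; lia.
rewrite (modn_small xn); move: xn; rewrite leq_eqVlt => /predU1P[x2n|x2n];
  first by rewrite x2n modnn; lia.
by rewrite modn_small //; lia.
Qed.

Section Targets.
Variables (t : nat) (k : nat -> nat) (s m : nat) (H : sgraph 'I_m).
Hypothesis k2 : forall i : 'I_t, 1 < k i.+1.
Let U := {i : 'I_t & 'I_(2 * k i.+1)}.
Variable f : {ffun U -> 'I_s + 'I_m}.
Hypothesis f_inj : injective f.
Hypothesis f_hom : forall u v, adj (even_cycles t k) u v ->
  adj (graph_join (complete_graph s) H) (f u) (f v).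

(** Indexes the edges of [F] by their first endpoint; as no cycle has length 2, distinct [u] give
    distinct edges. *)
Definition next_vertex (u : U) : U := Tagged (fun i : 'I_t => 'I_(2 * k i.+1)) (ordS (tagged u)).

Lemma next_vertex_inj : injective next_vertex.
Proof.
move=> [i a] [i' b] /eqP; rewrite -tag_eqE /tag_eq /= => /andP[/eqP ii']; subst i'.
by rewrite tagged_asE => /eqP/ordS_inj ->.
Qed.

Lemma next_vertex2_neq u : next_vertex (next_vertex u) != u.
Proof.
case: u => i a; rewrite -tag_eqE /tag_eq /= eqxx tagged_asE -val_eqE /=.
by apply/eqP/modn_succ2_neq => //; have := k2 i; clear; lia.
Qed.

Lemma adj_next_vertex u : adj (even_cycles t k) u (next_vertex u).
Proof.
rewrite adj_graph_of_rel; apply/andP; split.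
  apply: contra (next_vertex2_neq u) => /eqP uu; by rewrite -uu -uu.
case: u => i a; apply/orP; left; rewrite /= eqxx /= tagged_asE adj_graph_of_rel /= eqxx andbT.
rewrite -val_eqE eq_sym /=.
by apply/eqP/modn_succ_neq => //; have := k2 i; clear; lia.
Qed.

Definition hub (u : U) := if f u is inl _ then true else false.

Lemma sum_hub : \sum_u hub u <= s.
Proof.
have -> : \sum_u hub u = #|[set u | hub u]|.
  by rewrite -sum1_card [RHS]big_mkcond; apply: eq_bigr => u _; rewrite inE; case: (hub u).
rewrite -(card_imset _ f_inj) -[leqRHS](card_ord s) -(card_imset _ (@inl_inj 'I_s 'I_m)).
apply/subset_leq_card/subsetP => x /imsetP[u]; rewrite inE /hub => + ->.
by case: (f u) => // a _; apply/imsetP; exists a.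
Qed.

Lemma nonhub_edge u v : adj (even_cycles t k) u v -> ~~ hub u -> ~~ hub v ->
  exists x y, [/\ f u = inr x, f v = inr y & adj H x y].
Proof.
move=> /f_hom; rewrite /hub; case: (f u) (f v) => // x [] // y + _ _.
rewrite adj_graph_of_rel [adj H y x]adj_sym orbb => /andP[_ exy].
by exists x, y.
Qed.

Lemma card_vertices : #|{: U}| = 2 * \sum_(1 <= i < t.+1) k i.
Proof.
rewrite card_tagged sumnE big_map big_enum /= big_add1 /= big_mkord big_distrr.
by apply: eq_bigr => i _; rewrite card_ord.
Qed.

End Targets.

(* The s hubs meet at most 2 s of the 2 b edges of F, so at least two edges of F
   avoid them. *)
Lemma graph_E_free (t : nat) (k : nat -> nat) (s m : nat) :
  (forall i : 'I_t, 1 < k i.+1) -> s < \sum_(1 <= i < t.+1) k i ->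
  graph_free (even_cycles t k) (graph_join (complete_graph s) (one_edge_graph m)).
Proof.
move=> k2 sb; apply/negP => /existsP[f /andP[/injectiveP f_inj /forallP f_hom']].
have f_hom u v : adj (even_cycles t k) u v ->
    adj (graph_join (complete_graph s) (one_edge_graph m)) (f u) (f v).
  by have /forallP/(_ v)/implyP := f_hom' u.
have few := sum_hub f_inj.
pose D := [set u | ~~ hub f u & ~~ hub f (next_vertex u)].
have : 1 < #|D|.
  have : #|{: {i : 'I_t & 'I_(2 * k i.+1)}}| <= #|D| + \sum_u hub f u + \sum_u hub f (next_vertex u).
    rewrite -addnA -big_split -!sum1_card [X in _ <= X + _]big_mkcond -big_split /=.
    by apply: leq_sum => u _; rewrite inE; case: (hub f u); case: (hub f (next_vertex u)).
  have -> : \sum_u hub f (next_vertex u) = \sum_u hub f u by rewrite [RHS](reindex_inj (@next_vertex_inj t k)).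
  by rewrite card_vertices; move: few sb; clear; lia.
case/card_gt1P => u [v [uD vD uv]].
have edge w : w \in D -> exists x y, [/\ f w = inr x, f (next_vertex w) = inr y, x < 2, y < 2 & x != y].
  rewrite inE => /andP[h1 h2];
    have [x [y [-> ->]]] := nonhub_edge f_hom (adj_next_vertex k2 w) h1 h2.
  rewrite adj_graph_of_rel => /andP[xy xy01]; exists x, y; split=> //; move: xy01; clear; lia.
have [x [y [fu fsu x2 y2 xy]]] := edge u uD.
have [x' [y' [fv fsv x'2 y'2 xy']]] := edge v vD.
(* Only the edge [{0, 1}] is available, so two edges of [F] must cross it in opposite directions,
   which would make [next_vertex] return to [u] after two steps. *)
have xx' : x != x' by apply: contra uv => /eqP xx'; apply/eqP/f_inj; rewrite fu fv xx'.
have yx' : x' = y by apply: val_inj; move: x2 y2 x'2 xy xx'; rewrite -!val_eqE /=; clear; lia.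
have xy'' : y' = x by apply: val_inj; move: x2 y'2 x'2 xy' xx'; rewrite -!val_eqE /=; clear; lia.
have vu : v = next_vertex u by apply: f_inj; rewrite fv fsu yx'.
have uv' : next_vertex v = u by apply: f_inj; rewrite fu fsv xy''.
by have := next_vertex2_neq k2 u; rewrite -vu uv' eqxx.
Qed.

Lemma sum_cyclic4 m (h : 'I_m -> bool) : m = 4 ->
  (forall j, [|| h j, h (ordS j) | h (ordS (ordS j))]) -> 2 <= \sum_j h j.
Proof.
move=> m4; subst m => hj; rewrite !big_ord_recl big_ord0.
set j0 := ord0; set j1 := lift _ _; set j2 := lift _ _; set j3 := lift _ _.
have e0 : ordS j0 = j1 by apply: val_inj.
have e1 : ordS j1 = j2 by apply: val_inj.
have e2 : ordS j2 = j3 by apply: val_inj.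
have e3 : ordS j3 = j0 by apply: val_inj.
have := hj j0; have := hj j1; have := hj j2; have := hj j3.
rewrite !(e0, e1, e2, e3).
by case: (h j0); case: (h j1); case: (h j2); case: (h j3).
Qed.

(* Every C_4 uses at least two hubs, as a matching has no path on 3 vertices. *)
Lemma graph_L1_free (t : nat) (k : nat -> nat) (s m : nat) :
  (forall i : 'I_t, k i.+1 = 2) -> s < \sum_(1 <= i < t.+1) k i ->
  graph_free (even_cycles t k) (graph_join (complete_graph s) (matching_graph m)).
Proof.
move=> k2 sb; apply/negP => /existsP[f /andP[/injectiveP f_inj /forallP f_hom']].
have k1 (i : 'I_t) : 1 < k i.+1 by rewrite k2.
have f_hom u v : adj (even_cycles t k) u v ->
    adj (graph_join (complete_graph s) (matching_graph m)) (f u) (f v).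
  by have /forallP/(_ v)/implyP := f_hom' u.
have few := sum_hub f_inj.
have consec u : [|| hub f u, hub f (next_vertex u) | hub f (next_vertex (next_vertex u))].
  apply/negPn/negP; rewrite !negb_or => /and3P[h1 h2 h3].
  have [x [y [fu fsu exy]]] := nonhub_edge f_hom (adj_next_vertex k1 u) h1 h2.
  have [y' [z [fsu' fssu eyz]]] := nonhub_edge f_hom (adj_next_vertex k1 (next_vertex u)) h2 h3.
  have yy' : y' = y by move: fsu'; rewrite fsu => -[].
  subst y'; have : x != z.
    by apply: contra (next_vertex2_neq k1 u) => /eqP xz; apply/eqP/f_inj; rewrite fu fssu xz.
  move: exy eyz; rewrite !adj_graph_of_rel -!val_eqE /=; move: (val x) (val y) (val z) => a b c.
  by rewrite ![b./2 == _]eq_sym !orbb; clear; lia.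
suff : \sum_(1 <= i < t.+1) k i <= \sum_u hub f u by rewrite leqNgt (leq_ltn_trans few sb).
rewrite big_add1 /= big_mkord.
have -> : \sum_u hub f u =
    \sum_(i < t) \sum_(j < 2 * k i.+1) hub f (Tagged (fun i : 'I_t => 'I_(2 * k i.+1)) j).
  rewrite (@sig_big_dep _ _ _ 'I_t (fun i : 'I_t => 'I_(2 * k i.+1)) xpredT (fun _ => xpredT)
    (fun i j => hub f (Tagged (fun i : 'I_t => 'I_(2 * k i.+1)) j) : nat)).
  by apply: eq_bigr => -[].
apply: leq_sum => i _; rewrite [leqLHS]k2;
  apply: (@sum_cyclic4 _ (fun j => hub f (Tagged (fun i : 'I_t => 'I_(2 * k i.+1)) j))).
  by rewrite k2.
by move=> j; apply: consec (Tagged (fun i : 'I_t => 'I_(2 * k i.+1)) j).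
Qed.

(** * Identification of the extremal graph *)

Section Join.
Variables (s m : nat) (H : sgraph 'I_m).
Let T := graph_join (complete_graph s) H.

Lemma adj_join_inl i v : adj T (inl i) v = (inl i != v).
Proof.
rewrite adj_graph_of_rel; case: v => [j|//]; rewrite !adj_graph_of_rel /= !andbT.
by rewrite (inj_eq (@inl_inj _ _)) [j == i]eq_sym orbb andbb.
Qed.

Lemma adj_join_inr x y : adj T (inr x) (inr y) = adj H x y.
Proof.
rewrite adj_graph_of_rel (inj_eq (@inr_inj _ _)) [adj H y x]adj_sym orbb.
by have [->|//] := eqVneq x y; rewrite adj_irr.
Qed.

Lemma degree_sum (V : finType) (G : sgraph V) x : degree G x = \sum_y adj G x y.
Proof. by rewrite degree_deg degE; apply: eq_bigl => y; rewrite inE. Qed.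

Lemma degree_join_inl i : degree T (inl i) = (s + m).-1.
Proof.
rewrite -[s in RHS]card_ord -[m in RHS]card_ord -card_sum -(cardsC1 (inl i : 'I_s + 'I_m)).
by apply: eq_card => v; rewrite !inE adj_join_inl eq_sym.
Qed.

Lemma degree_join_inr x : degree T (inr x) = s + degree H x.
Proof.
rewrite !degree_sum big_sumType /= -[s in RHS]card_ord -sum1_card; congr (_ + _).
  by apply: eq_bigr => i _; rewrite adj_sym adj_join_inl.
by apply: eq_bigr => y _; rewrite adj_join_inr.
Qed.

Local Open Scope ring_scope.

(** A lower bound suffices for the comparison, so each vertex of [H] is credited with degree at most
    1. *)
Lemma degree_power_join_ge (R : realType) (p : R) (J : nat) : 0 <= p ->
  (J <= \sum_x (0 < degree H x))%N ->
  s%:R * (s + m).-1%:R `^ p + m%:R * s%:R `^ p + J%:R * (s.+1%:R `^ p - s%:R `^ p)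
    <= degree_power p T.
Proof.
move=> p0 leJ; rewrite /degree_power big_sumType /= -addrA; apply: lerD.
  under eq_bigr => i _ do rewrite degree_join_inl.
  by rewrite sumr_const card_ord mulr_natl.
apply: le_trans (_ : \sum_(x in setT) (s + (0 < degree H x)%N)%:R `^ p <= _).
  rewrite degree_01_power_sum; last by move=> x _; case: (0 < _)%N.
  rewrite cardsT card_ord lerD2l ler_wpM2r //; first by rewrite subr_ge0 ler_pow ?ler_nat.
  by rewrite ler_nat; apply: leq_trans leJ _; rewrite [leqRHS](eq_bigl xpredT) // => x;
    rewrite inE.
rewrite big_mkcond; apply: ler_sum => x _; rewrite inE degree_join_inr ler_pow ?ler_nat //.
by rewrite leq_add2l; case: (degree H x).
Qed.

End Join.

Lemma one_edge_sum m : 1 < m -> 2 <= \sum_x (0 < degree (one_edge_graph m) x).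
Proof.
move=> m1; pose a := Ordinal (ltnW m1); pose b := Ordinal m1.
have ab : adj (one_edge_graph m) a b by rewrite adj_graph_of_rel.
have da : 0 < degree (one_edge_graph m) a by apply/card_gt0P; exists b; rewrite inE.
have db : 0 < degree (one_edge_graph m) b by apply/card_gt0P; exists a; rewrite inE adj_sym.
by rewrite (bigD1 a) //= (bigD1 b) //= da db.
Qed.

Lemma matching_sum m : (m./2).*2 <= \sum_x (0 < degree (matching_graph m) x).
Proof.
have hm : (m./2).*2 <= m by lia.
apply: leq_trans (_ : \sum_(x < m) (x < (m./2).*2) <= _).
  rewrite -[leqLHS]card_ord -sum1_card (big_ord_widen _ (fun=> 1) hm) big_mkcond.
  by apply: leq_sum => x _; case: (_ < _).
apply: leq_sum => x _; case: ltnP => // xm; rewrite lt0b.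
have ym : (if odd x then x.-1 else x.+1) < m by case: ifP; lia.
apply/card_gt0P; exists (Ordinal ym); rewrite inE adj_graph_of_rel -val_eqE /=.
by case: ifP; lia.
Qed.

(** Normal form of a graph of maximum degree at most 1: matched pairs at positions [2 i] and
    [2 i + 1], then isolated vertices. Both target graphs have this form outside the hubs, so only
    the number [h] of edges remains to be compared. *)
Lemma pairing (V : finType) (e : rel V) (S : {set V}) : symmetric e -> irreflexive e ->
  {in S, forall x, deg e S x <= 1} ->
  exists w h, [/\ uniq w, w =i S, h.*2 <= size w, \sum_(x in S) deg e S x = h.*2 &
    forall x0 i j, i < size w -> j < size w ->
      e (nth x0 w i) (nth x0 w j) = [&& i != j, i./2 == j./2 & i < h.*2]].
Proof.
move=> e_sym e_irr; have [n] := ubnP #|S|; elim: n S => // n IH S leSn S1.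
have [/existsP[x /existsP[y /and3P[xS yS exy]]]|noedge] :=
  boolP [exists x, exists y, [&& x \in S, y \in S & e x y]]; last first.
  have no x y : x \in S -> y \in S -> e x y = false.
    move=> xS yS; apply: contraNF noedge => exy.
    by apply/existsP; exists x; apply/existsP; exists y; rewrite xS yS.
  exists (enum S), 0; split=> //.
  - exact: enum_uniq.
  - by move=> x; rewrite mem_enum.
  - rewrite big1 // => x xS; apply/eqP; rewrite cards_eq0; apply/eqP/setP => y.
    by rewrite !inE; case yS: (y \in S) => //=; rewrite no.
  - by move=> x0 i j il jl; rewrite no ?ltn0 ?andbF // -mem_enum mem_nth.
have only u v z : u \in S -> v \in S -> z \in S -> e u v -> e u z -> z = v.
  move=> uS vS zS euv euz; apply: (card_le1_eqP (S1 u uS)); by rewrite inE ?zS ?vS.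
have xy : x != y by apply: contraTneq exy => ->; rewrite e_irr.
have yx : y != x by rewrite eq_sym.
have eyx : e y x by rewrite e_sym.
pose S' := S :\ x :\ y.
have S'S : S' \subset S by apply: subset_trans (subsetDl _ _) (subsetDl _ _).
have far z : z \in S' -> e x z = false /\ e y z = false.
  rewrite !inE => /and3P[zy zx zS]; split; apply/negP => ez.
    by case/eqP: zy; apply: only ez.
  by case/eqP: zx; apply: only ez.
have cS : #|S| = #|S'|.+2 by rewrite (cardsD1 x) xS (cardsD1 y) !inE yS yx.
have [||w [h [uw ws hw sw ew]]] := IH S'.
- by move: leSn; rewrite cS; lia.
- by move=> z zS'; apply: leq_trans (S1 z (subsetP S'S z zS')); apply: deg_subset.
have memw z : z \in w -> z \in S' by rewrite ws.
exists [:: x, y & w], h.+1; split.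
- by rewrite /= inE negb_or xy uw !ws /S' !inE !eqxx xy !andbT /=.
- move=> z; rewrite !inE ws !inE.
  have [->|zx] := eqVneq z x; first by rewrite xS.
  by have [->|zy] := eqVneq z y; first by rewrite yS.
- by rewrite /= doubleS !ltnS.
- have deg1 u v : u \in S -> v \in S -> e u v -> deg e S u = 1.
    move=> uS vS euv; apply/eqP; rewrite eqn_leq S1 //=; apply/card_gt0P.
    by exists v; rewrite inE vS.
  rewrite (big_setD1 x) //= (big_setD1 y) /=; last by rewrite !inE yx.
  rewrite (deg1 x y) // (deg1 y x) // doubleS -sw !add1n; congr _.+2.
  apply: eq_bigr => z zS'; rewrite (degD1 e z xS) (degD1 e (S := S :\ x) (x := y));
    last by rewrite !inE yx.
  by have [exz eyz] := far z zS'; rewrite [e z x]e_sym [e z y]e_sym exz eyz !addn0.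
move=> x0 [|[|i]] [|[|j]] //= il jl.
- by rewrite (far _ _).1 // memw // mem_nth.
- by rewrite (far _ _).2 // memw // mem_nth.
- by rewrite e_sym (far _ _).1 ?memw ?mem_nth.
- by rewrite e_sym (far _ _).2 ?memw ?mem_nth.
- by rewrite ew // !eqSS doubleS !ltnS.
Qed.

Lemma join_isomorphic (V : finType) (G : sgraph V) (A : {set V}) (s m : nat) (H : sgraph 'I_m)
    (w : seq V) (x0 : V) :
  #|A| = s -> #|V| = s + m -> {in A, forall a, deg (adj G) setT a = #|V|.-1} ->
  uniq w -> w =i ~: A -> (forall i j : 'I_m, adj H i j = adj G (nth x0 w i) (nth x0 w j)) ->
  isomorphic G (graph_join (complete_graph s) H).
Proof.
move=> cA cV degA uw wA HG.
have hubE a x : a \in A -> adj G a x = (a != x).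
  (* Degree [#|V| - 1] leaves room for no non-neighbour except [a] itself. *)
  move=> aA; have : [set y in setT | adj G a y] == [set~ a].
    rewrite eqEcard cardsC1 -(degA a aA) leqnn andbT; apply/subsetP => y; rewrite !inE /=.
    by apply: contraTneq => ->; rewrite adj_irr.
  by move=> /eqP/setP/(_ x); rewrite !inE /= eq_sym => ->.
have szA : size (enum A) = s by rewrite -cardE.
have szw : size w = m.
  have : #|~: A| = m by have := cardsC A; rewrite cA cV => /addnI.
  by rewrite -(card_uniqP uw) => <-; apply: eq_card => x; rewrite wA.
pose g (u : 'I_s + 'I_m) := match u with inl i => nth x0 (enum A) i | inr j => nth x0 w j end.
have gA i : g (inl i) \in A by rewrite -mem_enum mem_nth // szA.
have gw j : g (inr j) \notin A.
  by have := mem_nth x0 (_ : j < size w); rewrite wA inE; apply; rewrite szw.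
have g_inj : injective g.
  move=> [i|j] [i'|j'] gg.
  - congr inl; apply/ord_inj/eqP; rewrite -(nth_uniq x0 _ _ (enum_uniq A)) ?szA //.
    exact/eqP.
  - by have := gw j'; rewrite -gg gA.
  - by have := gw j; rewrite gg gA.
  - by congr inr; apply/ord_inj/eqP; rewrite -(nth_uniq x0 _ _ uw) ?szw //; apply/eqP.
have [g' gK g'K] : bijective g by apply: inj_card_bij; rewrite // cV card_sum !card_ord.
exists g'; first by exists g.
move=> x y; rewrite -{2}(g'K x) -{2}(g'K y); move: (g' x) (g' y) => u v.
have inlE i z : adj (graph_join (complete_graph s) H) (inl i) z = adj G (g (inl i)) (g z).
  by rewrite adj_join_inl hubE // (inj_eq g_inj).
case: u v => [i|j] [i'|j'] //; first by rewrite adj_sym inlE adj_sym.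
by rewrite adj_join_inr HG.
Qed.

(** * Assembly of the two cases *)

Theorem theorem4p1 (R : realType) (t : nat) (k : nat -> nat) (p : R)
  (ht : 1 <= t)
  (hk2 : 2 <= k 1)
  (hkmono : forall i j, 1 <= i -> i <= j -> j <= t -> k i <= k j)
  (hp : ((k 1%N)%:R / ((k 1%N)%:R - 1) < p)%R) :
  let F := even_cycles t k in
  let b := \sum_(1 <= i < t.+1) k i in
  exists n0 : nat, forall n : nat, n0 <= n ->
  forall (V : finType) (G : sgraph V), #|V| = n ->
    graph_free F G ->
    degree_power p G = ex_degree_power p n F ->
    ((forall i, 1 <= i -> i <= t -> k i = 2) -> isomorphic G (graph_L1 n (b - 1))) /\
    (3 <= k t -> isomorphic G (graph_E n (b - 1))).
Proof.
move=> F b; have k_ge2 i : 1 <= i <= t -> 1 < k i.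
  by case/andP=> i1 it; apply: leq_trans hk2 (hkmono 1 i _ _ _).
have k_ge2' (i : 'I_t) : 1 < k i.+1 by apply: k_ge2; rewrite /= ltn_ord.
have sum_ks : sumn [seq k i | i <- iota 1 t] = b by rewrite sumnE big_map /b /index_iota subn1.
pose ks := [seq k i | i <- iota 2 t.-1].
have ksE : [seq k i | i <- iota 1 t] = k 1 :: ks by rewrite /ks -[in LHS](prednK ht).
have k_ks : all (leq (k 1)) ks.
  apply/allP => x /mapP[i]; rewrite mem_iota => /andP[i2 it] ->; apply: hkmono => //; lia.
pose s := (k 1 + sumn ks).-1.
have b_s : b = s.+1 by rewrite -sum_ks ksE /= prednK //; lia.
have p0 : (0 <= p)%R by have := exponent_gt1 hk2 hp; lra.
have [n1 struct] := extremal_structure hk2 k_ks hp; rewrite -/s in struct.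
(* [n >= s + 2] leaves two vertices for the edge of [one_edge_graph]. *)
exists (maxn n1 (s + 2)) => n; rewrite geq_max => /andP[nn1 ns] V G cV Gfree Gext.
have nocyc : ~ has_cycles (adj G) setT (k 1 :: ks).
  rewrite -ksE => cyc; move/negP: Gfree; apply; apply: contains_even_cycles => //.
  exact: ltnW.
have degG : (degree_power p G = \sum_v (deg (adj G) setT v)%:R `^ p)%R.
  by apply: eq_bigr => v _; rewrite degree_deg.
have cT m : #|{: 'I_s + 'I_m}| = s + m by rewrite card_sum !card_ord.
have nE : s + (n - s) = n by lia.
rewrite b_s subn1 /=.
have /card_gt0P[x0 _] : 0 < #|V| by rewrite cV; move: ns; clear; lia.
(* The two cases differ only in [H], the number [h] of its edges, and the reason why the common
   neighbourhood spans at most [h] edges. *)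
have finish (H : sgraph 'I_(n - s)) (h : nat) :
    graph_free F (graph_join (complete_graph s) H) ->
    h.*2 <= \sum_x (0 < degree H x) ->
    (forall A : {set V}, #|A| = s -> s.+1 < #|common (adj G) A| ->
      {in common (adj G) A, forall x, deg (adj G) (common (adj G) A) x <= 1} ->
      \sum_(x in common (adj G) A) deg (adj G) (common (adj G) A) x <= h.*2) ->
    (forall i j : 'I_(n - s), adj H i j = [&& i != j, i./2 == j./2 & i < h.*2]) ->
    isomorphic G (graph_join (complete_graph s) H).
  move=> Hfree Hh Jmax HE.
  have := degree_power_join_ge s p0 Hh; rewrite nE -{1 2}cV => big.
  have {}big := le_trans big (ex_degree_power_ge p (etrans (cT _) nE) Hfree).
  rewrite -Gext degG in big; rewrite -cV in nn1.
  have [A [cA degA A1 sumA]] := struct V (adj G) h.*2 (@adj_sym _ G) (@adj_irr _ G) nocyc nn1 Jmax big.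
  have [w [h' [uw wA _ sumA' wE]]] := pairing (@adj_sym _ G) (@adj_irr _ G) A1.
  have szw : size w = n - s.
    by rewrite -(card_uniqP uw) (eq_card wA) cardsCs setCK cA cV.
  have hh' : h' = h by apply: double_inj; rewrite -sumA' sumA.
  apply: (join_isomorphic (x0 := x0) cA _ degA uw wA); first by rewrite cV nE.
  by move=> i j; rewrite HE wE ?szw // hh' -val_eqE.
split=> [all2|k3].
  apply: (finish _ ((n - s)./2)).
  - apply: graph_L1_free; last by rewrite -/b b_s.
    by move=> i; apply: all2.
  - exact: matching_sum.
  (* There are at most [n - s] common neighbours, so a matching on them has at most [(n - s)./2]
     edges. *)
  - move=> A cA _ A1; have [w [h [uw wA hw -> _]]] := pairing (@adj_sym _ G) (@adj_irr _ G) A1.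
    have : #|common (adj G) A| <= n - s.
      have := card_common_leftover A (@adj_irr _ G); rewrite cA cV; lia.
    by rewrite -(eq_card wA) (card_uniqP uw) leq_double -[h]doubleK => wn;
      apply/half_leq/(leq_trans hw).
  - move=> i j; rewrite adj_graph_of_rel [j./2 == _]eq_sym orbb -val_eqE /=.
    have := ltn_ord i; have := ltn_ord j; clear; lia.
apply: (finish _ 1).
- by apply: graph_E_free; rewrite // -/b b_s.
- by apply: one_edge_sum; lia.
(* Two disjoint edges among the common neighbours would complete a copy of [F], the cycle of length
   [2 k_t >= 6] passing through both. *)
- move=> A cA lX A1; have [w [h [uw wA hw -> wE]]] := pairing (@adj_sym _ G) (@adj_irr _ G) A1.
  rewrite leqNgt; apply/negP => h2; apply: nocyc; rewrite -ksE.
  pose ks' := [seq k i | i <- iota 1 t.-1].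
  have ks'E : [seq k i | i <- iota 1 t] = rcons ks' (k t).
    have tE : t = t.-1 + 1 by rewrite addn1 prednK.
    by rewrite [in LHS]tE iotaD map_cat /= cats1 add1n prednK.
  have sum' : k t + sumn ks' = s.+1.
    by rewrite -b_s -sum_ks ks'E sumn_rcons addnC.
  rewrite ks'E; case: w uw wA hw wE => [|x1 [|x2 [|x3 [|x4 w]]]] uw wA hw wE;
    try by move: hw h2 => /=; lia.
  apply: (@two_edges_has_cycles _ _ (@adj_sym _ G) (@adj_irr _ G) A (common (adj G) A)
    (@common_complete _ _ A) (k t) ks' x1 x2 x3 x4) => //.
  - by rewrite sum' cA.
  - by rewrite sum'.
  - by move=> x; rewrite -wA !inE => /or4P[] /eqP->; rewrite eqxx ?orbT.
  - by move: uw; rewrite -[[:: x1, x2, x3, x4 & w]]/([:: x1; x2; x3; x4] ++ w) cat_uniq => /andP[].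
  - by rewrite (wE x0 0 1) //= double_gt0; move: h2; clear; lia.
  - by rewrite (wE x0 2 3) //=; move: h2; clear; lia.
- move=> i j; rewrite adj_graph_of_rel -val_eqE /=.
  have := ltn_ord i; have := ltn_ord j; clear; lia.
Qed.
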